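(* Suppose $(\Gamma, G) \in \mathcal{OG}(4)$ is basic of cycle type and does not have independent cyclic normal quotients. Then one of the following holds. 1. All cyclic normal quotients of $(\Gamma, G)$ are $G$-oriented and either (a) $\mathrm{soc}(G)$ is a $2$-group and $\Gamma$ is isomorphic to one of the graphs $\overline{\mathbf{C}}_r(2, t)$ for some $r\geq 3$ and $t \geq 1$; or (b) $G$ has a unique minimal normal subgroup $N \cong T^k$, where $k\geq 1$ and where $T$ is a simple group, $T\ncong \mathbb{Z}_2$, and $\Gamma_N \cong \mathbf{C}_r$ for some $r \geq 3$. In this case (i) $k\leq r2^r$ if $N$ is nonabelian; or (ii) $k \leq r$ if $N$ is abelian. 2. All cyclic normal quotients of $(\Gamma, G)$ are $G$-unoriented and $G$ has a unique minimal normal subgroup $N \cong T^k$, where $k\geq 1$ and where $T$ is a simple group, and $\Gamma_N \cong \mathbf{C}_r$ for some $r \geq 3$. In this case (i) $k\leq 2r$ if $N$ is nonabelian; or (ii) $k \leq r-1$ if $N$ is abelian.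
   Context: All groups and graphs are finite; graphs are simple and undirected. Simple groups may be abelian (cyclic of prime order). $\mathrm{soc}(G)$ is the subgroup generated by all minimal normal subgroups of $G$. For $G\le \mathrm{Aut}(\Gamma)$, $\Gamma$ is $G$-oriented if $G$ is transitive on the vertices and on the edges of $\Gamma$ but not on the arcs (ordered pairs of adjacent vertices). $\mathcal{OG}(4)$ is the set of pairs $(\Gamma,G)$ with $\Gamma$ a connected $4$-valent graph, $G\leq \mathrm{Aut}(\Gamma)$, and $\Gamma$ $G$-oriented. For $N\unlhd G$, the $G$-normal quotient $\Gamma_N$ is the graph whose vertices are the $N$-orbits on $V\Gamma$, two distinct $N$-orbits being adjacent iff there is an edge of $\Gamma$ between a vertex of one and a vertex of the other. $\tilde N$ denotes the kernel of the action of $G$ on the set of $N$-orbits in $V\Gamma$. $\mathbf{C}_r$ ($r\ge 3$) denotes the cycle graph with $r$ vertices. $\Gamma_N$ is degenerate if it is isomorphic to $K_1$, $K_2$ or $\mathbf{C}_r$ for some $r\geq 3$. The pair $(\Gamma,G)\in\mathcal{OG}(4)$ is basic if $\Gamma_N$ is degenerate for every nontrivial normal subgroup $N$ of $G$. A cyclic normal quotient is a $\Gamma_N$, $N\unlhd G$, isomorphic to $\mathbf{C}_r$ for some $r\geq 3$; it is $G$-oriented if $G/\tilde N\cong C_r$ (cyclic of order $r$) and $G$-unoriented if $G/\tilde N\cong D_r$ (dihedral of order $2r$); one of these always holds. A basic pair is of cycle type if it has at least one cyclic normal quotient. Two cyclic normal quotients $\Gamma_M,\Gamma_N$ are independent if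 $\Gamma_K$, with $K=\tilde M\cap\tilde N$, is not a cycle. For $r\ge3$, $t\ge1$, $\overline{\mathbf{C}}_r(2,t)$ is the underlying undirected graph of the digraph $\mathbf{C}_r(2,t)$ with vertex set $\mathbb{Z}_r\times\mathbb{Z}_2^t$ in which $((i,\mathbf{x}),(j,\mathbf{y}))$, with $\mathbf{x}=(x_1,\dots,x_t)$ and $\mathbf{y}=(y_1,\dots,y_t)$, is a directed edge if and only if $j=i+1$ and $\mathbf{y}=(y_1,x_1,\dots,x_{t-1})$. *)

(* Defs.v *)
From mathcomp Require Import all_boot all_fingroup all_algebra all_solvable.

Set Implicit Arguments.
Unset Strict Implicit.
Unset Printing Implicit Defensive.

Import GroupScope.

(** * Finite simple graphs *)

Record sgraph := SGraph {
  svertex :> finType;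
  sedge : rel svertex;
  sedge_sym : symmetric sedge;
  sedge_irrefl : irreflexive sedge }.

Definition graph_iso (X Y : sgraph) : Prop :=
  exists2 f : X -> Y, bijective f & forall x y, sedge (f x) (f y) = sedge x y.

Definition connected_graph (X : sgraph) : Prop :=
  forall x y : X, connect (@sedge X) x y.

Definition regular_graph (d : nat) (X : sgraph) : Prop :=
  forall x : X, #|[set y | sedge x y]| = d.

Definition edge_set (X : sgraph) : {set {set X}} :=
  [set [set x; y] | x in [set: X], y in [set: X] & sedge x y].

Definition arc_set (X : sgraph) : {set 2.-tuple X} :=
  [set a | sedge (tnth a 0%R) (tnth a 1%R)].

Definition graph_aut (X : sgraph) : {set {perm X}} :=
  [set g : {perm X} | [forall x, forall y, sedge (g x) (g y) == sedge x y]].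

Definition Kn_rel (n : nat) : rel 'I_n := fun x y => x != y.

Lemma Kn_sym n : symmetric (@Kn_rel n).
Proof. by move=> x y; rewrite /Kn_rel eq_sym. Qed.

Lemma Kn_irrefl n : irreflexive (@Kn_rel n).
Proof. by move=> x; rewrite /Kn_rel eqxx. Qed.

Definition Kn (n : nat) : sgraph := SGraph (@Kn_sym n) (@Kn_irrefl n).

(* Only meant for r >= 3; recall that 'Z_0 and 'Z_1 are both 'Z_2. *)
Definition Cn_rel (r : nat) : rel 'Z_r :=
  fun i j => (j == i + 1)%R || (i == j + 1)%R.

Lemma Zp_succ_neq r (i : 'Z_r) : (i == i + 1)%R = false.
Proof. by rewrite -{1}[i]GRing.addr0 (inj_eq (GRing.addrI i)). Qed.

Lemma Cn_sym r : symmetric (@Cn_rel r).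
Proof. by move=> i j; rewrite /Cn_rel orbC. Qed.

Lemma Cn_irrefl r : irreflexive (@Cn_rel r).
Proof. by move=> i; rewrite /Cn_rel Zp_succ_neq. Qed.

Definition Cn (r : nat) : sgraph := SGraph (@Cn_sym r) (@Cn_irrefl r).

Definition is_cycle (X : sgraph) : Prop :=
  exists2 r : nat, 3 <= r & graph_iso X (Cn r).

Definition degenerate (X : sgraph) : Prop :=
  [\/ graph_iso X (Kn 1), graph_iso X (Kn 2) | is_cycle X].

(* The arcs of the digraph C_r(2,t), for r >= 3 and t >= 1: for
   x = (x_1, ..., x_t), the truncated sequence on the right is
   (y_1, x_1, ..., x_(t-1)). *)
Definition C2_arc (r t : nat) : rel ('Z_r * t.-tuple 'Z_2) :=
  fun u v => (v.1 == u.1 + 1)%R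
    && (v.2 == head 0%R v.2 :: take t.-1 u.2 :> seq 'Z_2).

Definition C2_rel (r t : nat) : rel ('Z_r * t.-tuple 'Z_2) :=
  fun u v => C2_arc u v || C2_arc v u.

Lemma C2_sym r t : symmetric (@C2_rel r t).
Proof. by move=> u v; rewrite /C2_rel orbC. Qed.

Lemma C2_irrefl r t : irreflexive (@C2_rel r t).
Proof. by move=> u; rewrite /C2_rel /C2_arc Zp_succ_neq. Qed.

Definition C2_graph (r t : nat) : sgraph :=
  SGraph (@C2_sym r t) (@C2_irrefl r t).

(** * Normal quotients *)

Section NormalQuotient.

Variable X : sgraph.
Implicit Types G N M : {group {perm X}}.

Definition orbits_of N : {set {set X}} := orbit 'P N @: [set: X].

Definition nq_rel N : rel {B : {set X} | B \in orbits_of N} :=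
  fun B C => (B != C)
    && [exists x in val B, exists y in val C, sedge x y].

Lemma nq_sym N : symmetric (@nq_rel N).
Proof.
suff nq1 B C : @nq_rel N B C -> nq_rel C B by move=> B C; apply/idP/idP; apply: nq1.
case/andP=> neqBC /exists_inP[x Bx /exists_inP[y Cy xy]].
rewrite /nq_rel eq_sym neqBC; apply/exists_inP; exists y => //.
by apply/exists_inP; exists x; rewrite // sedge_sym.
Qed.

Lemma nq_irrefl N : irreflexive (@nq_rel N).
Proof. by move=> B; rewrite /nq_rel eqxx. Qed.

Definition normal_quotient N : sgraph := SGraph (@nq_sym N) (@nq_irrefl N).

(* The pointwise stabiliser in G of the set of N-orbits, that is, the kernel
   of the action of G on the N-orbits. *)
Definition nq_kernel G N : {group {perm X}} := 'C_G(orbits_of N | 'P^*)%G.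

Definition G_oriented G : Prop :=
  [/\ [transitive G, on [set: X] | 'P],
      [transitive G, on edge_set X | 'P^*]
    & ~~ [transitive G, on arc_set X | 'P * 2]].

Definition OG4 G : Prop :=
  [/\ connected_graph X, regular_graph 4 X, G \subset graph_aut X
    & G_oriented G].

Definition basic_pair G : Prop :=
  forall N, N <| G -> N :!=: 1 -> degenerate (normal_quotient N).

Definition cyclic_nq G N : Prop := N <| G /\ is_cycle (normal_quotient N).

Definition cycle_type G : Prop := exists N, cyclic_nq G N.

Definition oriented_nq G N : Prop :=
  exists2 r : nat, 3 <= r &
    graph_iso (normal_quotient N) (Cn r) /\ (G / nq_kernel G N) \isog Zp r.

Definition unoriented_nq G N : Prop :=
  exists2 r : nat, 3 <= r &
    graph_iso (normal_quotient N) (Cn r) /\ (G / nq_kernel G N) \isog 'D_(2 * r)%N.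

Definition independent_nq G M N : Prop :=
  ~ is_cycle (normal_quotient (nq_kernel G M :&: nq_kernel G N)%G).

Definition has_independent_nq G : Prop :=
  exists M N, [/\ cyclic_nq G M, cyclic_nq G N & independent_nq G M N].

End NormalQuotient.

(** * Minimal normal subgroups *)

Section Groups.

Variable gT : finGroupType.
Implicit Types G N : {group gT}.

Definition minimal_normal G N : bool := (N \subset G) && minnormal N G.

Definition soc G : {set gT} := <<\bigcup_(N : {group gT} | minimal_normal G N) N>>.

Definition unique_minimal_normal G N : Prop :=
  minimal_normal G N /\ forall M : {group gT}, minimal_normal G M -> M :=: N.

End Groups.

Definition gpower (gT : finGroupType) (T : {group gT}) (k : nat) :
  {group {dffun forall i : 'I_k, gT}} := [group of setXn (fun _ : 'I_k => T)].

(* Main.v *)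
Require Import Defs.
From mathcomp Require Import all_boot all_fingroup all_algebra all_solvable.
From mathcomp Require Import ring.

(** The group G has two orbits on the arcs of the graph; one of them, called a
    below, orients every edge. The resulting digraph has in- and out-valency 2
    and is strongly connected, and G is transitive on its arcs. An element of G
    that fixes a vertex and one of its two out-neighbours fixes the other one;
    so an element is trivial as soon as it fixes a vertex and cannot stop fixing
    along the arcs ([fix_eq1]). Most of the rigidity used in the proof comes from
    this remark. For instance vertex stabilisers are 2-groups ([stab_2group]).

    A cyclic quotient by N is a level function l from the vertices to the
    integers modulo r whose fibres are the N-orbits; every edge changes the level
    by one, and every element of G rotates or reflects the levels. There are two
    types. If the two out-neighbours of a vertex lie on one level, then all arcs
    go up (for l or for its opposite), G rotates the levels, and the quotient is
    oriented. Otherwise the out-neighbours of a vertex lie on both adjacent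
    levels; then the kernel of the action on levels fixes all out-neighbours of
    every vertex that it fixes, so it is semiregular, it coincides with N, and
    the quotient is unoriented with group dihedral of order 2r.

    The absence of independent cyclic quotients makes the kernels of cyclic
    quotients stable under intersection, so there is a least one, K
    ([least_cyclic_kernel]), and its type is shared by all cyclic quotients
    ([out_same_least]).

    Oriented type. A minimal normal subgroup N that meets K trivially would
    centralise K, which contains all vertex stabilisers, and an element swapping
    two out-neighbours gives a contradiction; so N lies in K and its quotient is
    a cycle. Two distinct minimal normal subgroups M and N have the same orbits,
    hence the order of M divides that of a vertex stabiliser in M N, and M is a
    2-group. Thus either every minimal normal subgroup is a 2-group, or there is
    only one and it is not. In the first case the graph is identified with
    C_r(2,t) by coordinates ([elementary_iso]): the t-th generation of
    descendants of a vertex depends on its level only, the generation before it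
    splits each level into two classes, and the coordinates of a vertex are the
    classes of its last t ancestors, itself included. In the second case, the
    conjugates of a simple factor of N generate N and N normalises each of them,
    so the number k of factors is at most the index of N in G, and this index is
    at most r 2^r because K/N has order at most 2^r ([kernel_card]). If N is
    abelian, an element carrying one out-neighbour of a vertex to the other spans
    a subgroup normalised by K, which has index r, whence k <= r.

    Unoriented type. Here K is the only minimal normal subgroup and has index 2r
    in G, which bounds k. If it is abelian, take a rotation s along an arc from v
    and the involution t fixing v: the element y = s s^t of K has at most r
    conjugates, and their quotients by y generate K unless y is central
    ([minnormal_class_grank]), whence k <= r - 1. *)

Set Implicit Arguments.
Unset Strict Implicit.
Unset Printing Implicit Defensive.

Import GroupScope.

(** * Groups: powers of a simple group and generation by conjugates *)

Lemma isog_bigdprod (I : Type) (aT rT : finGroupType) (s : seq I)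
    (A : I -> {group aT}) (B : I -> {group rT}) (G : {group aT})
    (L : {group rT}) :
    \big[dprod/1]_(i <- s) A i = G -> \big[dprod/1]_(i <- s) B i = L ->
  (forall i, A i \isog B i) -> G \isog L.
Proof.
move=> + + isoAB; elim: s G L => [|i s IHs] G L.
  by rewrite !big_nil => G1 L1 /=; apply: trivial_isog; rewrite -?G1 -?L1.
rewrite !big_cons => defG defL.
have [[_ A' _ defA] _ _ _] := dprodP defG.
have [[_ B' _ defB] _ _ _] := dprodP defL.
rewrite defA in defG; rewrite defB in defL.
exact: isog_dprod defG defL (isoAB i) (IHs _ _ defA defB).
Qed.

(** A minimal normal subgroup is characteristically simple, hence a direct
    product of images of one simple subgroup; T is taken among these factors, so
    that N normalises it. *)
Lemma minnormal_gpower (gT : finGroupType) (G N : {group gT}) :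
    minnormal N G ->
  exists (T : {group gT}) (k : nat),
    [/\ 0 < k, simple T, T \subset N /\ N \subset 'N(T),
        N \isog gpower T k & #|N| = (#|T| ^ k)%N].
Proof.
move=> minN; have ntN : N :!=: 1 by case/mingroupP: minN => /andP[].
have [H [sHN simH [I autI defN]]] := charsimple_dprod (minnormal_charsimple minN).
have [f0 If0] : exists f, f \in I.
  apply/set0Pn; apply: contraNneq ntN => I0.
  by rewrite -defN I0 big_set0.
have isoH f (If : f \in I) : exists2 K : {group gT}, K :=: f @: H & H \isog K.
  have Af := subsetP autI f If.
  exists (autm Af @* H)%G; first by rewrite /= morphimEsub // autmE.
  by rewrite sub_isog ?injm_autm.
pose F (i : 'I_#|I|) : {set gT} := enum_val i @: H.
have FG i : {K : {group gT} | K == F i :> {set gT} & H \isog K}.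
  apply: sig2W; have [K defK isoK] := isoH _ (enum_valP i).
  by exists K => //; apply/eqP.
pose K i := s2val (FG i).
have defK i : K i = F i :> {set gT} by apply/eqP; apply: (s2valP (FG i)).
have isoK i : H \isog K i by apply: (s2valP' (FG i)).
have defNK : \big[dprod/1]_i K i = N.
  by rewrite -defN [RHS]big_enum_val; apply: eq_bigr => i _; rewrite defK.
have I_gt0 : 0 < #|I| by apply/card_gt0P; exists f0.
pose i0 := Ordinal I_gt0; pose T := K i0.
have isoT i : K i \isog T by apply: isog_trans (isoK i0); rewrite isog_sym.
exists T, #|I|.
have oN : #|N| = (#|T| ^ #|I|)%N.
  rewrite -(bigdprod_card defNK) -[in RHS](card_ord #|I|) -prod_nat_const.
  by apply: eq_bigr => i _; apply: card_isog.
split=> //.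
- by rewrite -(isog_simple (isoK i0)).
- have := defNK; rewrite (bigD1 i0) //= => defN0.
  have [[_ R _ defR] _ _ _] := dprodP defN0; rewrite defR in defN0.
  by have [/andP[]] := dprod_normal2 defN0.
pose B (i : 'I_#|I|) := [group of set1gXn (gT := fun=> gT) (i := i) T].
have defB : \big[dprod/1]_i B i = gpower T #|I|.
  exact: (setXn_dprod (fun=> T)).
apply: (isog_bigdprod defNK defB) => i.
by apply: isog_trans (isoT i) _; apply: (isog_setXn (gT := fun=> gT)).
Qed.

(** The conjugates of H are normal in N, and they generate N because N is
    minimal; so N is their product. *)
Lemma minnormal_card_conjugates (gT : finGroupType) (G N H : {group gT}) :
    minnormal N G -> H \subset N -> H :!=: 1 -> N \subset 'N(H) ->
  #|N| <= #|H| ^ #|G : 'N_G(H)|.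
Proof.
case/mingroupP=> /andP[ntN nNG] minN sHN ntH nHN.
have key (s : seq {group gT}) :
    (forall K : {group gT}, K \in s -> N \subset 'N(K) /\ #|K| = #|H|) ->
  exists P : {group gT},
    [/\ N \subset 'N(P), #|P| <= #|H| ^ size s
      & forall K : {group gT}, K \in s -> K \subset N -> K \subset P].
  elim: s => [|K s IHs] Ks.
    by exists 1%G; rewrite norms1 cards1; split.
  have [|P [nPN oP Ps]] := IHs; first by move=> L sL; apply: Ks; rewrite inE sL orbT.
  have [nKN oK] := Ks K (mem_head _ _).
  exists (K <*> (P :&: N))%G.
  have nKP : P :&: N \subset 'N(K) by rewrite subIset ?nKN ?orbT.
  split.
  - by rewrite normsY // normsI ?normG.
  - rewrite /= (norm_joinEr nKP).
    rewrite (leq_trans (dvdn_leq _ (dvdn_cardMg _ _))) ?muln_gt0 ?cardG_gt0 //.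
    rewrite oK /= expnS leq_mul2l (leq_trans _ oP) ?orbT //.
    exact: subset_leq_card (subsetIl _ _).
  - move=> L; rewrite inE => /predU1P[-> | sL] sLN; first exact: joing_subl.
    by apply: subset_trans (joing_subr _ _); rewrite subsetI Ps.
(* s lists the conjugates of H, as many as the index of the normaliser *)
pose s := enum (orbit 'JG%act G H).
have sP (K : {group gT}) : K \in s -> exists2 x, x \in G & K = (H :^ x)%G.
  by rewrite mem_enum => /imsetP[x Gx ->]; exists x.
have [K|P [nPN oP Ps]] := key s.
  case/sP=> x Gx ->; rewrite cardJg; split=> //=.
  by rewrite -(normsP nNG x Gx) normJ conjSg.
have size_s : size s = #|G : 'N_G(H)|.
  by rewrite -cardE card_orbit astab1JG.
rewrite -size_s; apply: leq_trans oP; apply: subset_leq_card.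
pose M := <<class_support H G>>%G.
suff defM : M :=: N.
  rewrite -defM gen_subG class_supportEr; apply/bigcupsP=> x Gx.
  apply: Ps; first by rewrite mem_enum; apply: (mem_orbit 'JG%act).
  by rewrite /= -(normsP nNG x Gx) conjSg.
have sMN : M \subset N.
  rewrite gen_subG class_supportEr; apply/bigcupsP=> x Gx.
  by rewrite -(normsP nNG x Gx) conjSg.
apply: minN => //; apply/andP; split.
  apply: contraNneq ntH => M1; rewrite -subG1 -M1.
  exact: subset_trans (sub_class_support _ _) (subset_gen _).
by apply: norms_gen; apply: class_support_norm.
Qed.

(** * Orienting the edges *)

(** The relation a is one of the two orbits of G on the arcs of a graph on
    which G acts with in- and out-valency 2. *)
Record orientation (X : finType) (G : {group {perm X}}) (a : rel X) : Prop := {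
  arc_act : forall g x y, g \in G -> a (g x) (g y) = a x y;
  arc_trans : forall x y x' y', a x y -> a x' y' ->
    exists2 g, g \in G & g x = x' /\ g y = y';
  arc_out : forall x, #|[set y | a x y]| = 2;
  arc_in : forall y, #|[set x | a x y]| = 2;
  arc_asym : forall x y, a x y -> ~~ a y x;
  arc_connect : forall x y, connect a x y }.

(** Both orbits of G on arcs contain one orientation of each edge; otherwise
    an arc could be reversed and G would be transitive on arcs. Counting arcs by
    origin and by end shows that in- and out-valency agree, so both are 2. *)
Lemma orientation_exists (X : sgraph) (G : {group {perm X}}) : OG4 G ->
  exists2 a : rel X, orientation G a & forall x y, sedge x y = a x y || a y x.
Proof.
case=> connX regX autG [transV transE /negP ntransA].
have sedgeG g (x y : X) : g \in G -> sedge (g x) (g y) = sedge x y.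
  by move/(subsetP autG); rewrite inE => /forallP/(_ x)/forallP/(_ y)/eqP.
have transVP (x y : X) : exists2 g, g \in G & g x = y.
  have := in_setT y; rewrite -(atransP transV x (in_setT x)).
  by case/orbitP=> g Gg /= <-; exists g.
have [x0 _] : exists x : X, x \in [set: X].
  by case/imsetP: transV => x Xx _; exists x.
have [y0 xy0] : exists y0, sedge x0 y0.
  have : 0 < #|[set y | sedge x0 y]| by rewrite regX.
  by case/card_gt0P=> y; rewrite inE => xy; exists y.
pose a : rel X := fun x y => [exists g in G, (g x0 == x) && (g y0 == y)].
have aP x y : reflect (exists2 g, g \in G & g x0 = x /\ g y0 = y) (a x y).
  apply: (iffP exists_inP) => [[g Gg /andP[/eqP gx /eqP gy]] | [g Gg [gx gy]]].
    by exists g.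
  by exists g; rewrite // gx gy !eqxx.
have actA g x y : g \in G -> a (g x) (g y) = a x y.
  move=> Gg; apply/aP/aP => [[h Gh [hx hy]] | [h Gh [<- <-]]].
    exists (h * g^-1); rewrite ?groupM ?groupV // !permM hx hy !permK.
    by [].
  by exists (h * g); rewrite ?groupM // !permM.
have a_edge x y : a x y -> sedge x y by case/aP=> g Gg [<- <-]; rewrite sedgeG.
have edgeE x y : sedge x y = a x y || a y x.
  apply/idP/orP=> [xy | [/a_edge|/a_edge] //]; last by rewrite sedge_sym.
  have Eset (u v : X) : sedge u v -> [set u; v] \in edge_set X.
    by move=> uv; apply/imset2P; exists u v; rewrite ?inE.
  have := Eset _ _ xy; rewrite -(atransP transE _ (Eset _ _ xy0)).
  case/orbitP=> g Gg; rewrite /= setactE /= !imsetU1 !imset_set1 /= /aperm.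
  move/setP=> eq2; have ag : a (g x0) (g y0).
    by rewrite actA //; apply/aP; exists 1; rewrite ?group1 ?perm1.
  have ne : x != y by apply: contraTneq xy => ->; rewrite sedge_irrefl.
  have := eq2 x; have := eq2 y; rewrite !inE !eqxx ?orbT.
  case/orP=> /eqP ey /orP[] /eqP ex.
  - by rewrite ex ey eqxx in ne.
  - by right; rewrite ex ey.
  - by left; rewrite ex ey.
  by rewrite ex ey eqxx in ne.
have asymA x y : a x y -> ~~ a y x.
  move=> axy; apply/negP=> ayx; apply: ntransA.
  have a00 : a y0 x0.
    by case/aP: axy ayx => g Gg [<- <-]; rewrite actA.
  have edge_a u v : sedge u v -> a u v.
    rewrite edgeE => /orP[] // /aP[g Gg [<- <-]]; by rewrite actA.
  apply/imsetP; exists [tuple x0; y0]; first by rewrite inE.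
  apply/setP=> t; case/tupleP: t => u t; case/tupleP: t => w t.
  rewrite (tuple0 t) inE !(tnth_nth u) /=.
  apply/idP/orbitP=> [/edge_a/aP[g Gg [gx gy]] | [g Gg /(congr1 val)/=[<- <-]]].
    by exists g => //; apply: val_inj; rewrite /= !apermE gx gy.
  by rewrite !apermE sedgeG.
have transA x y x' y' : a x y -> a x' y' -> exists2 g, g \in G & g x = x' /\ g y = y'.
  case/aP=> g Gg [<- <-] /aP[h Gh [<- <-]].
  by exists (g^-1 * h); rewrite ?groupM ?groupV // !permM !permK.
have outG g x : g \in G -> #|[set y | a (g x) y]| = #|[set y | a x y]|.
  move=> Gg; rewrite -[RHS](card_imset _ (@perm_inj _ g)); apply: eq_card => y.
  rewrite inE; apply/idP/imsetP => [gxy | [z]].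
    by exists (g^-1 y); rewrite ?permKV // inE -(actA g) ?permKV.
  by rewrite inE => xz ->; rewrite actA.
have inG g x : g \in G -> #|[set y | a y (g x)]| = #|[set y | a y x]|.
  move=> Gg; rewrite -[RHS](card_imset _ (@perm_inj _ g)); apply: eq_card => y.
  rewrite inE; apply/idP/imsetP => [gxy | [z]].
    by exists (g^-1 y); rewrite ?permKV // inE -(actA g) ?permKV.
  by rewrite inE => xz ->; rewrite actA.
have deg x : #|[set y | a x y]| + #|[set y | a y x]| = 4.
  rewrite -(regX x) -cardsUI; set I := _ :&: _; have -> : I = set0.
    by apply/setP=> y; rewrite !inE; apply/negP=> /andP[/asymA/negP].
  by rewrite cards0 addn0; apply: eq_card => y; rewrite !inE edgeE.
have sum_eq : \sum_x #|[set y | a x y]| = \sum_x #|[set y | a y x]|.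
  under eq_bigr do rewrite -sum1dep_card big_mkcond.
  under [RHS]eq_bigr do rewrite -sum1dep_card big_mkcond.
  exact: exchange_big.
have outE x : #|[set y | a x y]| = #|[set y | a x0 y]|.
  by have [g Gg <-] := transVP x0 x; apply: outG.
have inE' x : #|[set y | a y x]| = #|[set y | a y x0]|.
  by have [g Gg <-] := transVP x0 x; apply: inG.
have eq_io : #|[set y | a x0 y]| = #|[set y | a y x0]|.
  move: sum_eq; under eq_bigr do rewrite outE.
  under [RHS]eq_bigr do rewrite inE'.
  rewrite !sum_nat_const => /eqP; rewrite eqn_pmul2l => [/eqP //|].
  by apply/card_gt0P; exists x0.
have out2 : #|[set y | a x0 y]| = 2.
  have := deg x0; rewrite -eq_io addnn => /(congr1 half).
  by rewrite doubleK.
exists a => //; split=> // [x | y |]; first by rewrite outE.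
  by rewrite inE' -eq_io.
(* Strong connectivity: all reachability sets have the same size, and along an arc
   they are nested, hence equal. *)
have reachG g x : g \in G -> #|connect a (g x)| = #|connect a x|.
  move=> Gg.
  have sub h u v : h \in G -> connect a u v -> connect a (h u) (h v).
    move=> Gh /connectP[p]; elim: p u => [|w p IHp] u /=; first by move=> _ ->.
    case/andP=> uw /IHp/[apply]; apply: connect_trans.
    by apply: connect1; rewrite actA.
  rewrite -(card_imset (connect a x) (@perm_inj _ g)); apply: eq_card => y.
  rewrite unfold_in /=; apply/idP/imsetP => [gxy | [z]].
    exists (g^-1 y); rewrite ?permKV // unfold_in /=.
    by have := sub _ _ _ (groupVr Gg) gxy; rewrite permK.
  by rewrite unfold_in /= => xz ->; apply: sub.
have reach_back x y : a x y -> connect a y x.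
  move=> xy; have oxy : #|connect a y| = #|connect a x|.
    by have [g Gg <-] := transVP x y; rewrite reachG.
  have sxy : connect a y \subset connect a x.
    by apply/subsetP=> z; rewrite !unfold_in /=; apply/connect_trans/connect1.
  suff : x \in connect a y by [].
  by rewrite (subset_cardP oxy sxy); apply: connect0.
move=> x y; apply: connect_sub (connX x y) => u v.
by rewrite edgeE => /orP[/connect1 | /reach_back].
Qed.

(** * Stabilisers in the oriented digraph *)

Lemma set2_other (T : finType) (A : {set T}) y : #|A| = 2 -> y \in A ->
  exists z, [/\ z \in A, z != y & forall u, u \in A -> u = y \/ u = z].
Proof.
move=> oA Ay; have : (#|A :\ y| == 1)%N by have := cardsD1 y A; rewrite oA Ay add1n => -[<-].
case/cards1P=> z defA; have : z \in A :\ y by rewrite defA set11.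
rewrite !inE => /andP[neq_zy Az]; exists z; split=> // u Au.
have [-> | neq_uy] := eqVneq u y; first by left.
by right; apply/set1P; rewrite -defA !inE neq_uy.
Qed.

Lemma cycle_fix (T : finType) (g h : {perm T}) x :
  g x = x -> h \in <[g]> -> h x = x.
Proof.
move=> gx /cycleP[i ->]; elim: i => [|i IHi]; first by rewrite expg0 perm1.
by rewrite expgSr permM IHi.
Qed.

Section Orientation.

Variables (X : finType) (G : {group {perm X}}) (a : rel X).
Hypothesis oriG : orientation G a.

Lemma out_exists x : exists y, a x y.
Proof.
have : 0 < #|[set y | a x y]| by rewrite (arc_out oriG).
by case/card_gt0P=> y; rewrite inE; exists y.
Qed.

Lemma in_exists y : exists x, a x y.
Proof.
have : 0 < #|[set x | a x y]| by rewrite (arc_in oriG).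
by case/card_gt0P=> x; rewrite inE; exists x.
Qed.

Lemma out_other x y : a x y ->
  exists z, [/\ a x z, z != y & forall u, a x u -> u = y \/ u = z].
Proof.
move=> xy; have [|z [+ neq_zy eq_yz]] := set2_other (y := y) (arc_out oriG x).
  by rewrite inE.
by rewrite inE => xz; exists z; split=> // u xu; apply: eq_yz; rewrite inE.
Qed.

Lemma in_other x y : a x y ->
  exists z, [/\ a z y, z != x & forall u, a u y -> u = x \/ u = z].
Proof.
move=> xy; have [|z [+ neq_zx eq_xz]] := set2_other (y := x) (arc_in oriG y).
  by rewrite inE.
by rewrite inE => zy; exists z; split=> // u uy; apply: eq_xz; rewrite inE.
Qed.

(** Out-valency 2 leaves no room for moving just one out-neighbour. *)
Lemma out_fix g x y z : g \in G -> g x = x -> a x y -> g y = y -> a x z -> g z = z.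
Proof.
move=> Gg gx xy gy xz; have [u [xu neq_uy outx]] := out_other xy.
have [-> // | ->] := outx _ xz.
have [] // := outx (g u); first by rewrite -{1}gx (arc_act oriG).
by rewrite -{1}gy => /perm_inj eq_uy; rewrite eq_uy eqxx in neq_uy.
Qed.

Lemma out_swap x y z : a x y -> a x z -> exists g, [/\ g \in G, g x = x & g y = z].
Proof. by move=> xy xz; have [g Gg [gx gy]] := arc_trans oriG xy xz; exists g. Qed.

Lemma vertex_trans x y : exists2 g, g \in G & g x = y.
Proof.
have [[x' xx'] [y' yy']] := (out_exists x, out_exists y).
by have [g Gg []] := arc_trans oriG xx' yy'; exists g.
Qed.

Lemma reach_ind (P : X -> Prop) x :
  P x -> (forall u v, P u -> a u v -> P v) -> forall y, P y.
Proof.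
move=> Px stepP y; have /connectP[p] := arc_connect oriG x y.
elim: p x Px => [|u p IHp] x Px /=; first by move=> _ ->.
by case/andP=> xu; apply: IHp; apply: stepP xu.
Qed.

Lemma fix_eq1 (g : {perm X}) x : g x = x ->
  (forall u v, g u = u -> a u v -> g v = v) -> g = 1.
Proof.
move=> gx stepg; apply/permP=> y; rewrite perm1.
exact: (reach_ind (P := fun u => g u = u)) gx stepg y.
Qed.

(** An element of odd order fixing u cannot swap the two out-neighbours of u,
    so it fixes them, and then everything. *)
Lemma stab_2group (H : {group {perm X}}) x :
  H \subset G -> (forall h, h \in H -> h x = x) -> 2.-group H.
Proof.
move=> sHG Hx; apply/pgroupP=> p p_pr /(Cauchy p_pr)[h Hh oh].
rewrite inE; apply: contraTT p_pr => neq_p2; apply/negP=> p_pr.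
have odd_p : odd p by case: (even_prime p_pr) neq_p2 => // ->.
suff h1 : h = 1 by rewrite -oh h1 order1 in p_pr.
apply: (fix_eq1 (Hx h Hh)) => u v hu uv.
have [w [uw _ outu]] := out_other uv.
have imG i : a u ((h ^+ i) v).
  rewrite -{1}(cycle_fix hu (mem_cycle h i)) (arc_act oriG) //.
  by rewrite groupX // (subsetP sHG).
have [// | hv] : h v = v \/ h v = w by apply: outu (imG 1%N).
have h2v : (h ^+ 2) v = v.
  have [// | h2v] := outu _ (imG 2); suff eq_vw : v = w by rewrite h2v -eq_vw.
  by apply: (@perm_inj _ h); rewrite hv -{1}h2v expgS expg1 permM hv.
(* h is a power of its square, because its order is odd *)
apply: (cycle_fix h2v).
have : generator <[h]> (h ^+ 2) by rewrite generator_coprime oh coprimen2.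
by move/eqP <-; apply: cycle_id.
Qed.

End Orientation.

(** * Cyclic quotients as level functions *)

Lemma Zp_add2_neq r (i : 'Z_r) : 2 < r -> (i + 1 + 1 == i)%R = false.
Proof.
move=> r_gt2; apply/negP; rewrite -GRing.addrA -{2}[i]GRing.addr0.
move/eqP/GRing.addrI/(congr1 (@nat_of_ord _)).
rewrite -[(1 + 1)%R]/(2%:R : 'Z_r)%R val_Zp_nat ?(ltnW r_gt2) //= modn_small //.
Qed.

(** By injectivity, f never turns back while its argument runs around the
    cycle, so the sense given by its first step persists. *)
Lemma cycle_endo r (f : 'Z_r -> 'Z_r) : 2 < r -> injective f ->
    (forall i, f (i + 1) = f i + 1 \/ f i = f (i + 1) + 1)%R ->
  (forall i, f i = f 0 + i)%R \/ (forall i, f i = f 0 - i)%R.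
Proof.
move=> r_gt2 injf fS.
have turn i : (f (i + 1 + 1) == f i)%R = false.
  by rewrite (inj_eq injf) Zp_add2_neq.
have ind (P : 'Z_r -> Prop) : P 0%R -> (forall i, P i -> P (i + 1)%R) -> forall i, P i.
  move=> P0 PS i; rewrite -[i]natr_Zp; elim: (val i) => // n IHn.
  by rewrite -GRing.natr1; apply: PS.
case: (fS 0%R) => [f1 | f1]; rewrite GRing.add0r in f1; [left | right].
  suff fE : forall i, (f i = f 0 + i /\ f (i + 1) = f i + 1)%R by move=> i; case: (fE i).
  apply: ind => [|i [fi fi1]]; first by rewrite GRing.addr0 GRing.add0r.
  split; first by rewrite fi1 fi GRing.addrA.
  have [//|] := fS (i + 1)%R; rewrite fi1 => /GRing.addIr/eqP.
  by rewrite eq_sym turn.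
suff fE : forall i, (f i = f 0 - i /\ f i = f (i + 1) + 1)%R by move=> i; case: (fE i).
apply: ind => [|i [fi fi1]]; first by rewrite GRing.subr0 GRing.add0r.
split; first by rewrite GRing.opprD GRing.addrA -fi fi1 GRing.addrK.
by have [fi2|//] := fS (i + 1)%R; have := turn i; rewrite fi2 -fi1 eqxx.
Qed.

(** The vertices of a cyclic quotient are read as residues modulo r: l labels
    the N-orbits so that arcs join consecutive labels, and consecutive labels are
    joined by some arc, in one direction or the other. *)
Record cyclic_level (X : finType) (a : rel X) (N : {group {perm X}}) (r : nat)
    (l : X -> 'Z_r) : Prop := {
  lev_orbit : forall x y, (l x == l y) = (y \in orbit 'P N x);
  lev_arc : forall x y, a x y -> (l y = l x + 1 \/ l x = l y + 1)%R;
  lev_adj : forall i : 'Z_r, exists x y,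
    (a x y \/ a y x) /\ (l x = i /\ l y = i + 1)%R }.

Section Quotient.

Variables (X : sgraph) (G : {group {perm X}}) (a : rel X).
Hypothesis oriG : orientation G a.
Hypothesis edgeE : forall x y : X, sedge x y = a x y || a y x.

Lemma orbit_perm (N : {group {perm X}}) g x y : N <| G -> g \in G ->
  (g y \in orbit 'P N (g x)) = (y \in orbit 'P N x).
Proof.
move=> nNG; wlog suff: g x y / y \in orbit 'P N x -> g \in G -> g y \in orbit 'P N (g x).
  move=> W Gg; apply/idP/idP=> [/W|/W]; last exact.
  by move/(_ g^-1); rewrite !permK groupV; apply.
case/orbitP=> n Nn <- Gg; apply/orbitP; exists (n ^ g).
  by rewrite memJ_norm // (subsetP (normal_norm nNG)).
by rewrite /= /aperm /conjg !permM permK.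
Qed.

Lemma orbit_vertex_subproof (N : {group {perm X}}) (x : X) : orbit 'P N x \in orbits_of N.
Proof. exact: imset_f. Qed.

Definition orbit_vertex (N : {group {perm X}}) (x : X) : normal_quotient N :=
  exist _ (orbit 'P N x) (orbit_vertex_subproof N x).

Lemma orbit_vertex_surj (N : {group {perm X}}) (B : normal_quotient N) :
  exists x, B = orbit_vertex N x.
Proof.
case: B => B BN; have /imsetP[x _ defB] := BN.
by exists x; apply: val_inj.
Qed.

Lemma orbit_vertex_eq (N : {group {perm X}}) x y :
  (orbit_vertex N x == orbit_vertex N y) = (y \in orbit 'P N x).
Proof. by rewrite -val_eqE /= orbit_sym; apply/eqP/orbit_eqP. Qed.

Lemma orbit_vertex_adj (N : {group {perm X}}) (B C : normal_quotient N) : sedge B C ->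
  exists x y, [/\ sedge x y, B = orbit_vertex N x & C = orbit_vertex N y].
Proof.
case/andP=> _ /exists_inP[x Bx /exists_inP[y Cy xy]]; exists x, y; split=> //.
  have [x' defB] := orbit_vertex_surj B; rewrite defB in Bx *.
  by apply/eqP; rewrite orbit_vertex_eq.
have [y' defC] := orbit_vertex_surj C; rewrite defC in Cy *.
by apply/eqP; rewrite orbit_vertex_eq.
Qed.

(** G is transitive on arcs and permutes the N-orbits, so one arc inside an
    N-orbit forces all arcs, hence all vertices, into one orbit. *)
Lemma arc_out_orbit (N : {group {perm X}}) x y : N <| G ->
  a x y -> y \in orbit 'P N x -> forall z w, w \in orbit 'P N z.
Proof.
move=> nNG xy oxy z w; rewrite orbit_sym.
apply: (reach_ind oriG (P := fun w => z \in orbit 'P N w)) (w) => [|u v zu uv].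
  exact: orbit_refl.
have [g Gg [gx gy]] := arc_trans oriG xy uv.
apply: orbit_trans zu _; rewrite orbit_sym -gx -gy.
by rewrite orbit_perm.
Qed.

Lemma cyclic_level_exists (N : {group {perm X}}) r : N <| G -> 2 < r ->
    graph_iso (normal_quotient N) (Cn r) ->
  exists l : X -> 'Z_r, cyclic_level a N l.
Proof.
move=> nNG r_gt2 [f bij_f fE]; exists (fun x => f (orbit_vertex N x)).
have lE x y : (f (orbit_vertex N x) == f (orbit_vertex N y)) = (y \in orbit 'P N x).
  by rewrite (inj_eq (bij_inj bij_f)) orbit_vertex_eq.
have Zr1 : (1 != 0 :> 'Z_r)%R by apply: GRing.oner_neq0.
split=> // [x y xy | i].
  have : sedge (orbit_vertex N x) (orbit_vertex N y).
    rewrite /= /nq_rel orbit_vertex_eq; apply/andP; split.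
      apply/negP=> oxy; have all1 := arc_out_orbit nNG xy oxy.
      have [f' f'K fK] := bij_f.
      have [[x0 e0] [x1 e1]] := (orbit_vertex_surj (f' 0%R), orbit_vertex_surj (f' 1%R)).
      have : f' 0%R == f' 1%R :> normal_quotient N by rewrite e0 e1 orbit_vertex_eq all1.
      by rewrite (can_eq fK) eq_sym (negPf Zr1).
    apply/exists_inP; exists x; rewrite ?orbit_refl //.
    by apply/exists_inP; exists y; rewrite ?orbit_refl // edgeE xy.
  by rewrite -fE /= /Cn_rel => /orP[] /eqP; [left | right].
have [f' f'K fK] := bij_f.
have /orbit_vertex_adj[x [y [xy ex ey]]] : sedge (f' i) (f' (i + 1)%R).
  by rewrite -fE !fK /= /Cn_rel eqxx.
exists x, y; rewrite -ex -ey !fK; split=> //.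
by apply/orP; rewrite -edgeE.
Qed.

Section Level.

Variables (N : {group {perm X}}) (r : nat) (l : X -> 'Z_r).
Hypotheses (nNG : N <| G) (r_gt2 : 2 < r) (levl : cyclic_level a N l).

Lemma lev_surj i : exists x, l x = i.
Proof. by have [x [y [_ []]]] := lev_adj levl i; exists x. Qed.

Lemma lev_act_eq g x y : g \in G -> (l (g x) == l (g y)) = (l x == l y).
Proof. by move=> Gg; rewrite !(lev_orbit levl) orbit_perm. Qed.

Lemma lev_orbitP x y : l x = l y -> exists2 n, n \in N & n x = y.
Proof.
by move/eqP; rewrite (lev_orbit levl) => /orbitP[n Nn <-]; exists n.
Qed.

Lemma lev_act g : g \in G -> exists c : 'Z_r,
  (forall x, l (g x) = c + l x)%R \/ (forall x, l (g x) = c - l x)%R.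
Proof.
move=> Gg; have [x0 _] := lev_surj 0%R.
pose rep i := odflt x0 [pick x | l x == i].
have repE i : l (rep i) = i.
  rewrite /rep; case: pickP => [x /eqP // | no_x].
  by have [x lx] := lev_surj i; have := no_x x; rewrite lx eqxx.
pose f i := l (g (rep i)).
have fE x : f (l x) = l (g x) by apply/eqP; rewrite lev_act_eq // repE.
have injf : injective f.
  by move=> i j /eqP; rewrite lev_act_eq // !repE => /eqP.
have fS i : (f (i + 1) = f i + 1 \/ f i = f (i + 1) + 1)%R.
  have [x [y [axy [<- <-]]]] := lev_adj levl i; rewrite !fE.
  case: axy => [xy | yx].
    by apply: (lev_arc levl); rewrite (arc_act oriG).
  by apply/or_comm; apply: (lev_arc levl); rewrite (arc_act oriG).
exists (f 0%R); have [fP | fP] := cycle_endo r_gt2 injf fS; [left | right] => x.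
  by rewrite -fE.
by rewrite -fE.
Qed.

End Level.

End Quotient.

(** * Kernels and oriented cyclic quotients *)

Section Kernel.

Variables (X : sgraph) (G : {group {perm X}}).
Implicit Type N : {group {perm X}}.

Lemma imset_orbit N (g : {perm X}) x : N <| G -> g \in G ->
  g @: orbit 'P N x = orbit 'P N (g x).
Proof.
move=> nNG Gg; apply/setP=> y; apply/imsetP/idP => [[z oz ->]|oy].
  by rewrite (orbit_perm _ _ nNG).
exists (g^-1 y); last by rewrite permKV.
by rewrite -(orbit_perm _ _ nNG Gg) permKV.
Qed.

Lemma nq_kernelP N g : N <| G ->
  reflect (g \in G /\ forall x, g x \in orbit 'P N x) (g \in nq_kernel G N).
Proof.
move=> nNG; rewrite inE; apply: (iffP andP) => -[Gg].
  move/astabP=> fixg; split=> // x.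
  have <- := fixg (orbit 'P N x) (imset_f _ (in_setT x)).
  by apply: (imset_f (fun y => g y)); apply: orbit_refl.
move=> og; split=> //; apply/astabP=> _ /imsetP[x _ ->].
apply: etrans (imset_orbit x nNG Gg) _.
exact/orbit_eqP.
Qed.

Lemma nq_kernel_normal N : N <| G -> nq_kernel G N <| G.
Proof.
move=> nNG; apply/andP; split; first exact: subsetIl.
apply/subsetP=> g Gg; rewrite inE; apply/subsetP=> _ /imsetP[k Kk ->].
have [Gk ok] := nq_kernelP _ nNG Kk; apply/nq_kernelP=> //.
split=> [|x]; first by rewrite groupJ.
by rewrite /conjg !permM -{2}[x](permKV g) (orbit_perm _ _ nNG Gg) ok.
Qed.

Lemma nq_kernel_sub N : N <| G -> N \subset nq_kernel G N.
Proof.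
move=> nNG; apply/subsetP=> n Nn; apply/nq_kernelP=> //.
split=> [|x]; first by rewrite (subsetP (normal_sub nNG)).
exact: mem_orbit.
Qed.

Lemma nq_kernel_orbit N x : N <| G -> orbit 'P (nq_kernel G N) x = orbit 'P N x.
Proof.
move=> nNG; apply/eqP; rewrite eqEsubset; apply/andP; split; apply/subsetP=> y.
  by case/orbitP=> k /(nq_kernelP _ nNG)[_ ok] <-; apply: ok.
case/orbitP=> n Nn <-; apply: mem_orbit.
exact: subsetP (nq_kernel_sub nNG) n Nn.
Qed.

Lemma nq_kernel_act N g x : N <| G -> g \in nq_kernel G N ->
  exists2 n, n \in N & n x = g x.
Proof. by move=> nNG /(nq_kernelP _ nNG)[_ /(_ x)/orbitP[n Nn <-]]; exists n. Qed.

End Kernel.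

Section Types.

Variables (X : sgraph) (G : {group {perm X}}) (a : rel X).
Hypothesis oriG : orientation G a.

Variables (N : {group {perm X}}) (r : nat) (l : X -> 'Z_r).
Hypotheses (nNG : N <| G) (r_gt2 : 2 < r) (levl : cyclic_level a N l).

Lemma lev_norm n x : n \in N -> l (n x) = l x.
Proof. by move=> Nn; apply/esym/eqP; rewrite (lev_orbit levl); apply: mem_orbit. Qed.

Lemma lev_kernelP g :
  reflect (g \in G /\ forall x, l (g x) = l x) (g \in nq_kernel G N).
Proof.
apply: (iffP (nq_kernelP g nNG)) => -[Gg og]; split=> // x.
  by apply/esym/eqP; rewrite (lev_orbit levl).
by rewrite -(lev_orbit levl) og.
Qed.

(** This distinguishes the oriented cyclic quotients from the unoriented ones,
    without reference to a labelling of the orbits. *)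
Definition out_same (M : {group {perm X}}) := [forall x, forall y, forall z,
  a x y ==> a x z ==> (z \in orbit 'P M y)].

Lemma out_sameP (M : {group {perm X}}) :
  reflect (forall x y z, a x y -> a x z -> z \in orbit 'P M y) (out_same M).
Proof.
apply: (iffP forallP) => [H x y z xy xz | H x].
  by have /forallP/(_ y)/forallP/(_ z) := H x; rewrite xy xz.
by apply/forallP=> y; apply/forallP=> z; apply/implyP=> xy; apply/implyP; apply: H xy.
Qed.

(** Since N is transitive on levels, all arcs leaving a given level go the same
    way. Were the direction to change between two adjacent levels, no arc could
    leave their union. *)
Lemma oriented_level : out_same N -> exists2 l' : X -> 'Z_r,
  cyclic_level a N l' & forall x y, a x y -> (l' y = l' x + 1)%R.
Proof.
move/out_sameP=> sameN.
have lout x x' y y' : l x = l x' -> a x y -> a x' y' -> l y = l y'.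
  move=> /(lev_orbitP levl)[n Nn <-] xy nxy'.
  rewrite -(lev_norm y Nn); apply/eqP; rewrite (lev_orbit levl).
  by apply: sameN nxy'; rewrite (arc_act oriG) // (subsetP (normal_sub nNG)).
have no_back u w z : a u w -> a w z -> l z <> l u.
  move=> uw wz lzu.
  have two x : l x = l u \/ l x = l w.
    apply: (reach_ind oriG (P := fun x => l x = l u \/ l x = l w)) x.
      by left.
    move=> x y [lx|lx] xy; first by right; apply: lout xy uw.
    by left; rewrite -lzu; apply: lout xy wz.
  have [x lx] := lev_surj levl (l u + 1)%R; have [y ly] := lev_surj levl (l u + 1 + 1)%R.
  have [/eqP | lw] := two y; first by rewrite ly Zp_add2_neq.
  have [/eqP | ] := two x; first by rewrite lx eq_sym Zp_succ_neq.
  by rewrite lx -lw ly => /eqP; rewrite Zp_succ_neq.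
have [x0 _] := lev_surj levl 0%R; have [y0 xy0] := out_exists oriG x0.
have [up | down] := lev_arc levl xy0.
  exists l => //.
  apply: (reach_ind oriG (x := x0)) => [y xy|u v lu uv w vw].
    by rewrite (lout _ _ _ _ _ xy xy0).
  have [// | lw] := lev_arc levl vw; case: (no_back _ _ _ uv vw).
  by have := lu v uv; rewrite lw => /GRing.addIr.
(* all arcs go down for l, hence up for its opposite *)
exists (fun x => - l x)%R.
  split=> [x y | x y xy | i].
  - by rewrite (inj_eq GRing.oppr_inj) (lev_orbit levl).
  - have [-> | ->] := lev_arc levl xy.
      by right; rewrite GRing.opprD GRing.subrK.
    by left; rewrite GRing.opprD GRing.subrK.
  have [x [y [xy [lx ly]]]] := lev_adj levl (- (i + 1))%R.
  exists y, x; split; first exact/or_comm.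
  by rewrite ly lx GRing.opprD !GRing.opprK GRing.addrK.
suff dn : forall x y, a x y -> (l x = l y + 1)%R.
  by move=> x y /dn ->; rewrite GRing.opprD GRing.subrK.
apply: (reach_ind oriG (x := x0)) => [y xy|u v lu uv w vw].
  by rewrite (lout _ _ _ _ _ xy xy0).
have [lw | //] := lev_arc levl vw; case: (no_back _ _ _ uv vw).
by rewrite lw (lu v uv).
Qed.

Section Oriented.

Hypothesis levS : forall x y, a x y -> (l y = l x + 1)%R.

Lemma lev_rot g x y : g \in G -> (l (g x) - l x = l (g y) - l y)%R.
Proof.
move=> Gg; apply: (reach_ind oriG (P := fun y => l (g x) - l x = l (g y) - l y)%R) y => //.
move=> u v -> uv; rewrite (levS uv).
have /levS -> : a (g u) (g v) by rewrite (arc_act oriG).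
by rewrite GRing.opprD GRing.addrACA GRing.subrr GRing.addr0.
Qed.

Lemma lev_rot_kernel g x : g \in G -> l (g x) = l x -> g \in nq_kernel G N.
Proof.
move=> Gg lgx; apply/lev_kernelP; split=> // y.
by apply/eqP; rewrite -GRing.subr_eq0 -(lev_rot x y Gg) lgx GRing.subrr.
Qed.

(** The amount of the rotation is a morphism onto the residues modulo r. *)
Lemma oriented_isog : (G / nq_kernel G N) \isog Zp r.
Proof.
have [x0 _] := lev_surj levl 0%R.
pose rho (g : {perm X}) : 'Z_r := (l (g x0) - l x0)%R.
have rhoM : {in G &, {morph rho : g h / g * h}}.
  move=> g h Gg Gh; rewrite /rho permM.
  apply: etrans (_ : (l (g x0) - l x0) + (l (h (g x0)) - l (g x0)) = _)%R; last first.
    by rewrite (lev_rot (g x0) x0 Gh).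
  by rewrite [RHS]GRing.addrC GRing.addrA GRing.subrK.
pose f := Morphism rhoM.
have kerf : 'ker f = nq_kernel G N.
  apply/setP=> g; apply/idP/idP => [|Kg].
    case/morphpreP=> Gg /set1P fg; apply: (lev_rot_kernel (x := x0) Gg).
    by apply/eqP; rewrite -GRing.subr_eq0; apply/eqP.
  have [Gg lg] := lev_kernelP _ Kg; apply/kerP => //.
  by rewrite /= /rho lg GRing.subrr.
have imf : f @* G = Zp r.
  rewrite /Zp (ltnW r_gt2); apply/setP=> i; rewrite inE.
  have [x lx] := lev_surj levl (l x0 + i)%R.
  have [g Gg gx0] := vertex_trans oriG x0 x.
  apply/morphimP; exists g => //=; rewrite /rho gx0 lx.
  by rewrite [(l x0 + i)%R]GRing.addrC GRing.addrK.
by have := first_isog f; rewrite kerf imf.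
Qed.

Lemma oriented_index : #|G : nq_kernel G N| = r.
Proof.
rewrite -card_quotient ?normal_norm ?nq_kernel_normal //.
by rewrite (card_isog oriented_isog) card_Zp // (leq_trans _ r_gt2).
Qed.

End Oriented.

End Types.

(** * Unoriented cyclic quotients *)

Section Unoriented.

Variables (X : sgraph) (G : {group {perm X}}) (a : rel X).
Hypothesis oriG : orientation G a.

Variables (N : {group {perm X}}) (r : nat) (l : X -> 'Z_r).
Hypotheses (nNG : N <| G) (r_gt2 : 2 < r) (levl : cyclic_level a N l).
Hypothesis splitN : ~~ out_same a N.

(** The two out-neighbours of some vertex lie on different levels; G carries
    this to all vertices. *)
Lemma unoriented_out x : exists y z,
  [/\ a x y, a x z, l y = (l x + 1)%R & l x = (l z + 1)%R].
Proof.
have [x0 [y0 [z0 [xy xz neq_l]]]] : exists x y z, [/\ a x y, a x z & l y != l z].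
  move: splitN => /forallPn[x0 /forallPn[y0 /forallPn[z0]]].
  rewrite !negb_imply => /and3P[xy xz nyz]; exists x0, y0, z0.
  by rewrite (lev_orbit levl).
have [g Gg <-] := vertex_trans oriG x0 x.
have neq_gl : l (g y0) != l (g z0) by rewrite (lev_act_eq nNG levl).
have gxy : a (g x0) (g y0) by rewrite (arc_act oriG).
have gxz : a (g x0) (g z0) by rewrite (arc_act oriG).
have [ly | ly] := lev_arc levl gxy; have [lz | lz] := lev_arc levl gxz.
- by rewrite ly lz eqxx in neq_gl.
- by exists (g y0), (g z0).
- by exists (g z0), (g y0).
by case/eqP: neq_gl; apply: (@GRing.addIr _ 1%R); rewrite -ly.
Qed.

(** An element preserving the levels cannot exchange the out-neighbours of a
    vertex that it fixes, as they lie on different levels. *)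
Lemma unoriented_semireg g x : g \in nq_kernel G N -> g x = x -> g = 1.
Proof.
case/(lev_kernelP nNG levl)=> Gg lg gx; apply: (fix_eq1 oriG gx) => u v gu uv.
have [y [z [uy uz ly lz]]] := unoriented_out u.
suff gy : g y = y by apply: (out_fix oriG Gg gu uy gy uv).
have [w [uw _ outu]] := out_other oriG uy.
have [//|gy] : g y = y \/ g y = w.
  by apply: outu; rewrite -{1}gu (arc_act oriG).
have [zy | zw] := outu z uz.
  have := Zp_add2_neq (l z) r_gt2; rewrite -lz -ly zy.
  by rewrite eqxx.
have := lg y; rewrite gy -zw ly lz => /esym/eqP.
by rewrite Zp_add2_neq.
Qed.

Lemma unoriented_kernel : N :=: nq_kernel G N.
Proof.
apply/eqP; rewrite eqEsubset nq_kernel_sub //=.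
apply/subsetP=> k Kk; have [x _] := lev_surj levl 0%R.
have [n Nn nx] := nq_kernel_act x nNG Kk.
suff /eqP : k * n^-1 = 1 by rewrite -eq_mulgV1 => /eqP->.
apply: (unoriented_semireg (x := x)); last by rewrite permM -nx permK.
by rewrite groupM ?groupV // (subsetP (nq_kernel_sub nNG)).
Qed.

Lemma unoriented_free n x : n \in N -> n x = x -> n = 1.
Proof. by rewrite unoriented_kernel; apply: unoriented_semireg. Qed.

Lemma unoriented_mem g : g \in G -> (forall x, l (g x) = l x) -> g \in N.
Proof. by move=> Gg lg; rewrite unoriented_kernel; apply/(lev_kernelP nNG levl). Qed.

(** A stabilising element either fixes all levels, and is trivial by
    semiregularity, or reflects the levels around that of x; two such reflections
    differ by an element of the first kind. *)
Lemma unoriented_stab x : exists t : {perm X},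
  [/\ t \in G, t x = x, forall u, l (t u) = (l x + l x - l u)%R, t \notin N
    & forall g, g \in G -> g x = x -> g = 1 \/ g = t].
Proof.
have [y [z [xy xz ly lz]]] := unoriented_out x.
have neq_yz : l y != l z.
  by rewrite ly lz Zp_add2_neq.
have [t [Gt tx ty]] := out_swap oriG xy xz.
have fixE g : g \in G -> g x = x ->
    (forall u, l (g u) = l u) \/ (forall u, l (g u) = l x + l x - l u)%R.
  move=> Gg gx; have [c [lc | lc]] := lev_act oriG nNG r_gt2 levl Gg; have := lc x; rewrite gx.
    move=> c0; left=> u; rewrite lc; suff -> : c = 0%R by rewrite GRing.add0r.
    by apply: (@GRing.addIr _ (l x)); rewrite -c0 GRing.add0r.
  by move=> cE; right=> u; rewrite lc {1}cE GRing.subrK.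
have lt u : (l (t u) = l x + l x - l u)%R.
  by case: (fixE t Gt tx) => // /(_ y)/eqP; rewrite ty eq_sym (negPf neq_yz).
have fix1 g : g \in G -> g x = x -> (forall u, l (g u) = l u) -> g = 1.
  by move=> Gg gx /(unoriented_mem Gg) Ng; apply: unoriented_free gx.
exists t; split=> //.
  by apply/negP=> Nt; move: neq_yz; rewrite -ty (lev_norm levl) ?eqxx.
move=> g Gg gx; case: (fixE g Gg gx) => lg; first by left; apply: fix1.
right; apply/eqP; rewrite eq_mulgV1; apply/eqP/fix1.
- by rewrite groupM ?groupV.
- by rewrite permM gx -{1}tx permK.
move=> u; rewrite permM; have := lt (t^-1 (g u)); rewrite permKV lg => e.
rewrite -[RHS](_ : l x + l x - (l x + l x - l u) = l u)%R; last by ring.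
by rewrite e; ring.
Qed.

(** An element carrying x to its upper out-neighbour shifts the levels or
    reflects them; a reflection is corrected by the involution fixing x. *)
Lemma unoriented_rotation x : exists s : {perm X},
  [/\ s \in G, a x (s x) & forall u, l (s u) = (l u + 1)%R].
Proof.
have [y [z [xy xz ly lz]]] := unoriented_out x.
have [g Gg gx] := vertex_trans oriG x y.
have [c [lc | lc]] := lev_act oriG nNG r_gt2 levl Gg; have := lc x; rewrite gx ly => cE.
  exists g; split=> //; first by rewrite gx.
  move=> u; rewrite lc GRing.addrC; congr (_ + _)%R.
  by apply: (@GRing.addIr _ (l x)); rewrite -cE GRing.addrC.
have [t [Gt tx lt _ _]] := unoriented_stab x.
exists (t * g); split; rewrite ?groupM // ?permM ?tx ?gx // => u.
rewrite permM lc lt.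
have -> : c = (l x + 1 + l x)%R by rewrite cE GRing.subrK.
ring.
Qed.

Lemma unoriented_index : #|G : N| = (2 * r)%N.
Proof.
have [x _] := lev_surj levl 0%R; have [t [Gt tx lt Nt stab]] := unoriented_stab x.
have oX : #|X| = (r * #|N|)%N.
  have -> : #|X| = \sum_(i : 'Z_r) \sum_(x : X | l x == i) 1%N.
    by rewrite -sum1_card; apply: (partition_big l xpredT).
  rewrite -[r in RHS](card_ord r) -sum_nat_const.
  have -> : \sum_(i < r) #|N| = \sum_(i : 'Z_r) #|N|.
    by rewrite !sum_nat_const !card_ord Zp_cast ?(ltnW r_gt2).
  apply: eq_bigr => i _; have [y <-] := lev_surj levl i.
  rewrite sum1dep_card -(card_orbit_stab 'P N y).
  have -> : 'C_N[y | 'P] = 1.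
    apply/trivgP/subsetP=> n /setIP[Nn /astab1P ny].
    by rewrite inE; apply/eqP; apply: unoriented_free ny.
  rewrite cards1 muln1; apply: eq_card => u.
  by rewrite !inE eq_sym (lev_orbit levl).
have oG : #|G| = (#|X| * 2)%N.
  rewrite -(card_orbit_stab 'P G x); congr (_ * _)%N.
    apply: eq_card => u; rewrite !inE; apply/orbitP.
    by have [g Gg gx] := vertex_trans oriG x u; exists g.
  have -> : 'C_G[x | 'P] = [set 1; t].
    apply/setP=> g; apply/setIP/set2P=> [[Gg /astab1P gx] | [->|->]].
    - exact: stab.
    - by rewrite !group1.
    by split=> //; apply/astab1P.
  by rewrite cards2; case: eqP => // t1; rewrite -t1 group1 in Nt.
apply/eqP; rewrite -(eqn_pmul2l (cardG_gt0 N)) (Lagrange (normal_sub nNG)) oG oX.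
by rewrite [X in _ == X]mulnCA mulnC [(r * _)%N]mulnC.
Qed.

(** Modulo N, the involution t fixing x and the product of t with a rotation s
    by one are two reflections. They generate the whole quotient: a rotation is a
    power of s modulo N, and a reflection becomes a rotation when multiplied by
    t. *)
Lemma unoriented_isog : (G / nq_kernel G N) \isog 'D_(2 * r).
Proof.
have -> : nq_kernel G N = N by apply/val_inj; rewrite /= -unoriented_kernel.
have [x _] := lev_surj levl 0%R.
have [t [Gt tx lt Nt stab]] := unoriented_stab x.
have [s [Gs _ ls]] := unoriented_rotation x.
have nN g : g \in G -> g \in 'N(N) by apply/subsetP/normal_norm.
have Gts : t * s \in G by rewrite groupM.
have lts u : (l ((t * s)%g u) = l x + l x - l u + 1)%R by rewrite permM ls lt.
have tt : t * t \in N.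
  apply: unoriented_mem => [|u]; first by rewrite groupM.
  by rewrite permM !lt; ring.
have tsts : (t * s) * (t * s) \in N.
  apply: unoriented_mem => [|u]; first by rewrite groupM.
  by rewrite permM !lts; ring.
have order2 g : g \in G -> g * g \in N -> g \notin N -> #[coset N g] = 2.
  move=> Gg gg ng; apply: nt_prime_order => //.
    by rewrite expgS expg1 -morphM ?nN //; apply: coset_id.
  by apply: contra ng => /eqP; apply: coset_idr; apply: nN.
have Nts : t * s \notin N.
  apply/negP=> /(lev_norm levl x); rewrite lts GRing.addrK => /eqP.
  by rewrite eq_sym Zp_succ_neq.
have ot := order2 t Gt tt Nt; have ots := order2 _ Gts tsts Nts.
have ne : coset N t != coset N (t * s).
  apply/eqP; rewrite morphM ?nN // => /esym/(canRL (mulKg _)); rewrite mulVg => s1.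
  have /(lev_norm levl x) : s \in N by apply: coset_idr => //; apply: nN.
  by rewrite ls => /eqP; rewrite eq_sym Zp_succ_neq.
have := involutions_gen_dihedral ot ots ne.
suff -> : <<[set coset N t; coset N (t * s)]>> = G / N.
  by rewrite card_quotient ?normal_norm // unoriented_index.
set D := <<_>>.
have Dt : coset N t \in D by rewrite mem_gen // set21.
have Ds : coset N s \in D.
  rewrite -(mulKg (coset N t) (coset N s)) groupM ?groupV // -morphM ?nN //.
  by rewrite mem_gen // set22.
apply/eqP; rewrite eqEsubset; apply/andP; split.
  by rewrite gen_subG; apply/subsetP=> _ /set2P[] ->; rewrite mem_quotient.
apply/subsetP=> _ /morphimP[g _ Gg ->] /=.
have rotD h : h \in G -> (forall u, l (h u) = l u + (l (h x) - l x))%R -> coset N h \in D.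
  move=> Gh; set c := (_ - _)%R => lh.
  have lsn n u : (l ((s ^+ n)%g u) = l u + n%:R)%R.
    elim: n => [|n IHn]; first by rewrite expg0 perm1 GRing.addr0.
    by rewrite expgSr permM ls IHn -GRing.natr1 GRing.addrA.
  have Nk : h * (s ^+ c)^-1 \in N.
    apply: unoriented_mem => [|u]; first by rewrite groupM ?groupV ?groupX.
    have lsc v : (l v + c)%R = l ((s ^+ c)%g v) by rewrite lsn natr_Zp.
    by apply: (@GRing.addIr _ c); rewrite -[RHS]lh lsc permM permKV.
  have /eqP := coset_id Nk.
  rewrite morphM ?morphV ?nN ?groupV ?groupX // -eq_mulgV1 => /eqP->.
  by rewrite morphX ?nN // groupX.
have [c [lc | lc]] := lev_act oriG nNG r_gt2 levl Gg.
  by apply: rotD => // u; rewrite !lc GRing.addrK GRing.addrC.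
rewrite -(mulgK (coset N t) (coset N g)) groupM ?groupV // -morphM ?nN //.
apply: rotD => [|u]; rewrite ?groupM // !permM !lt !lc.
ring.
Qed.

End Unoriented.

(** * Elementary abelian 2-groups and the graphs C_r(2,t) *)

Section Descendants.

Variables (X : sgraph) (G : {group {perm X}}) (a : rel X).
Hypothesis oriG : orientation G a.
Hypothesis edgeE : forall x y : X, sedge x y = a x y || a y x.

(** The end-points of the directed walks of length j starting at u. *)
Fixpoint desc (j : nat) (u : X) : {set X} :=
  if j is j'.+1 then \bigcup_(w | a u w) desc j' w else [set u].

Lemma descSP j u z :
  reflect (exists2 w, a u w & z \in desc j w) (z \in desc j.+1 u).
Proof. by apply: (iffP bigcupP) => -[w uw wz]; exists w. Qed.

Lemma desc_addP i j u z :
  reflect (exists2 y, y \in desc i u & z \in desc j y) (z \in desc (i + j) u).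
Proof.
elim: i u => [|i IHi] u.
  rewrite add0n; apply: (iffP idP) => [uz | [y]]; first by exists u; rewrite ?set11.
  by move/set1P->.
apply: (iffP (descSP _ _ _)) => [[w uw /IHi[y wy yz]] | [y /descSP[w uw wy] yz]].
  by exists y => //; apply/descSP; exists w.
by exists w => //; apply/IHi; exists y.
Qed.

Lemma descSrP j u z :
  reflect (exists2 y, y \in desc j u & a y z) (z \in desc j.+1 u).
Proof.
rewrite -addn1; apply: (iffP (desc_addP _ _ _ _)) => -[y uy].
  by case/descSP=> w yw /set1P->; exists y.
by move=> yz; exists y => //; apply/descSP; exists z; rewrite ?set11.
Qed.

Lemma desc_le i j u v : i <= j -> desc i u = desc i v -> desc j u = desc j v.
Proof.
move=> /subnKC <- eq_i; apply/setP=> z.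
by apply/desc_addP/desc_addP=> -[y uy yz]; exists y; rewrite ?eq_i // -eq_i.
Qed.

Lemma desc_nonempty j u : exists z, z \in desc j u.
Proof.
elim: j u => [|j IHj] u; first by exists u; apply: set11.
have [w uw] := out_exists oriG u; have [z wz] := IHj w.
by exists z; apply/descSP; exists w.
Qed.

Lemma desc_act g j u z : g \in G -> (g z \in desc j (g u)) = (z \in desc j u).
Proof.
move=> Gg; elim: j u => [|j IHj] u; first by rewrite !inE (inj_eq perm_inj).
apply/descSP/descSP => [[w uw wz] | [w uw wz]].
  exists (g^-1 w); first by rewrite -(arc_act oriG _ _ Gg) permKV.
  by rewrite -IHj permKV.
by exists (g w); rewrite ?IHj // (arc_act oriG).
Qed.

Lemma desc_act_eq g j u v : g \in G -> desc j u = desc j v ->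
  desc j (g u) = desc j (g v).
Proof.
move=> Gg /setP eq_uv; apply/setP=> z.
by rewrite -[z](permKV g) !desc_act // eq_uv.
Qed.

Variables (N : {group {perm X}}) (r : nat) (l : X -> 'Z_r).
Hypotheses (nNG : N <| G) (levl : cyclic_level a N l).
Hypothesis levS : forall x y, a x y -> (l y = l x + 1)%R.
Hypotheses (abN : abelian N) (expN : forall n, n \in N -> n * n = 1).
Hypothesis minN : forall M : {group {perm X}},
  M <| G -> M \subset N -> M :!=: 1 -> N \subset M.

Lemma desc_lev j u z : z \in desc j u -> (l z = l u + j%:R)%R.
Proof.
elim: j u => [|j IHj] u; first by move/set1P->; rewrite GRing.addr0.
by case/descSP=> w uw /IHj ->; rewrite (levS uw) -GRing.natr1; ring.
Qed.

Let NG n : n \in N -> n \in G. Proof. exact/subsetP/normal_sub. Qed.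

Lemma abel_act n m x : n \in N -> m \in N -> n (m x) = m (n x).
Proof. by move=> Nn Nm; rewrite -!permM (centsP abN _ Nn). Qed.

(** The sets of j-th descendants are blocks for N on a level. By induction:
    the out-neighbours of u are w and m w with m in N of order 2, and n in N
    commutes with m, so that n permutes the two halves of the next generation. *)
Lemma desc_block j u u' z : l u = l u' -> z \in desc j u -> z \in desc j u' ->
  desc j u = desc j u'.
Proof.
elim: j u u' z => [|j IHj] u u' z lu.
  by move=> /set1P-> /set1P->.
case/descSP=> w uw wz /descSP[w' uw' wz'].
have lw : l w = l w' by rewrite (levS uw) (levS uw') lu.
have eq_w := IHj _ _ _ lw wz wz'.
have [v [uv neq_v outu]] := out_other oriG uw.
have [v' [uv' neq_v' outu']] := out_other oriG uw'.
suff eq_v : desc j v = desc j v'.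
  apply/setP=> y; apply/descSP/descSP=> -[x].
    by case/outu=> -> xy; [exists w'; rewrite // -eq_w | exists v'; rewrite // -eq_v].
  by case/outu'=> -> xy; [exists w; rewrite // eq_w | exists v; rewrite // eq_v].
have [n Nn nu] := lev_orbitP levl lu.
have [m Nm mw] : exists2 m, m \in N & m w = v.
  by apply: (lev_orbitP levl); rewrite (levS uw) (levS uv).
have aN x y : a x y -> a (n x) (n y) by rewrite (arc_act oriG) ?NG.
have := outu' (n w); rewrite -nu => /(_ (aN _ _ uw)).
have := outu' (n v); rewrite -nu => /(_ (aN _ _ uv)).
have nn x : n (n x) = x by rewrite -permM expN // perm1.
case=> [nv | nv] [nw | nw].
- by move: neq_v; rewrite -(inj_eq (@perm_inj _ n)) nv nw eqxx.
- rewrite -nw -[v]nn nv; apply/esym/desc_act_eq => //; exact: NG.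
- by rewrite -nv -mw abel_act // nw; apply: desc_act_eq; rewrite ?NG.
by move: neq_v; rewrite -(inj_eq (@perm_inj _ n)) nv nw eqxx.
Qed.

Definition desc_univ j := [forall u, forall v, (l u == l v) ==> (desc j u == desc j v)].

Lemma desc_univP j :
  reflect (forall u v, l u = l v -> desc j u = desc j v) (desc_univ j).
Proof.
apply: (iffP forallP) => [H u v lu | H u].
  by have /forallP/(_ v)/implyP := H u; rewrite lu eqxx => /(_ isT)/eqP.
by apply/forallP=> v; apply/implyP=> /eqP/H/eqP.
Qed.

(** The elements of N that move some vertex to one with a common out-neighbour
    generate a nontrivial normal subgroup, which is N by minimality. Each of them
    identifies the descendants of every vertex after at most one turn around the
    cycle: on reaching the level where it has this property. *)
Lemma desc_univ_exists : exists j, desc_univ j.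
Proof.
pose S := [set n in N | [exists u, exists w, a u w && a (n u) w]].
have sSN : S \subset N by apply/subsetP=> n; rewrite inE => /andP[].
have [x0 _] := lev_surj levl 0%R.
have sNS : N \subset <<S>>.
  apply: minN.
  - apply/andP; split; first by rewrite gen_subG (subset_trans sSN) ?normal_sub.
    apply: norms_gen; apply/subsetP=> g Gg; rewrite inE; apply/subsetP=> _ /imsetP[n Sn ->].
    move: Sn; rewrite !inE => /andP[Nn /existsP[u /existsP[w /andP[uw nuw]]]].
    rewrite memJ_norm ?(subsetP (normal_norm nNG)) // Nn /=.
    apply/existsP; exists (g u); apply/existsP; exists (g w).
    by rewrite /conjg !permM permK !(arc_act oriG) // uw.
  - by rewrite gen_subG.
  have [u ux0] := in_exists oriG x0.
  have [v [vx0 neq_vu _]] := in_other oriG ux0.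
  have [n Nn nu] : exists2 n, n \in N & n u = v.
    apply: (lev_orbitP levl); apply: (@GRing.addIr _ 1%R).
    by rewrite -(levS ux0) -(levS vx0).
  apply/trivgPn; exists n; last by apply: contraNneq neq_vu => n1; rewrite -nu n1 perm1.
  rewrite mem_gen // inE Nn; apply/existsP; exists u; apply/existsP; exists x0.
  by rewrite ux0 nu.
(* (Zp_trunc r).+2 is the number of levels, being the order of 'Z_r *)
exists (Zp_trunc r).+2.
pose H := [set n in N | [forall v, desc (Zp_trunc r).+2 (n v) == desc (Zp_trunc r).+2 v]].
have gH : group_set H.
  apply/group_setP; split=> [|n m].
    by rewrite inE group1; apply/forallP=> v; rewrite perm1.
  rewrite !inE => /andP[Nn /forallP nP] /andP[Nm /forallP mP].
  rewrite groupM //; apply/forallP=> v; rewrite permM.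
  by rewrite (eqP (mP _)) nP.
suff sSH : S \subset Group gH.
  apply/desc_univP=> u v /(lev_orbitP levl)[n /(subsetP sNS) Sn <-].
  have : n \in Group gH by apply: subsetP Sn; rewrite gen_subG.
  by rewrite inE => /andP[_ /forallP/(_ u)/eqP].
apply/subsetP=> n; rewrite !inE => /andP[Nn /existsP[u /existsP[w /andP[uw nuw]]]].
rewrite Nn; apply/forallP=> v; apply/eqP.
have [x vx] := desc_nonempty (l u - l v)%R v.
have lx : l u = l x by rewrite (desc_lev vx) natr_Zp; ring.
have [p Np pu] := lev_orbitP levl lx.
apply: (desc_le (i := (l u - l v)%R.+1)); first exact: ltn_ord.
apply: (desc_block (z := p w)).
- exact: (lev_norm levl).
- apply/descSrP; exists (n x); first by rewrite desc_act ?NG.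
  by rewrite -pu abel_act // (arc_act oriG) // NG.
by apply/descSrP; exists x; rewrite // -pu (arc_act oriG) // NG.
Qed.

Section Coordinates.

Variable s : nat.
Hypotheses (univS : desc_univ s.+1) (nunivS : ~~ desc_univ s).

Lemma desc_split v : exists2 v', l v' = l v & desc s v' <> desc s v.
Proof.
have [u0 [v0 [lu0 neq_uv]]] : exists u v, l u = l v /\ desc s u != desc s v.
  move: nunivS => /forallPn[u /forallPn[u']]; rewrite negb_imply => /andP[/eqP lu neq].
  by exists u, u'.
have [g Gg <-] := vertex_trans oriG v0 v.
exists (g u0); first by apply/eqP; rewrite (lev_act_eq nNG levl) ?lu0.
move=> eq_g; case/eqP: neq_uv.
by rewrite -[u0](permK g) -[v0](permK g); apply: desc_act_eq eq_g; rewrite groupV.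
Qed.

(** If the two out-neighbours of u had the same descendants of order s, then so
    would all vertices of the next level, because all vertices on the level of u
    have the same descendants of order s + 1. *)
Lemma desc_out_diff u w w' : a u w -> a u w' -> w != w' -> desc s w <> desc s w'.
Proof.
move=> uw uw' neq_w eq_w; have [v lv neq_v] := desc_split w; apply: neq_v.
have outE x : a u x -> desc s x = desc s w.
  move=> ux; have [y [uy _ outu]] := out_other oriG uw.
  have : y = w' by have [e|//] := outu w' uw'; rewrite e eqxx in neq_w.
  by move=> y'; case: (outu x ux) => -> //; rewrite y' eq_w.
have [y yv] := in_exists oriG v.
have ly : l y = l u.
  by apply: (@GRing.addIr _ 1%R); rewrite -(levS yv) lv (levS uw).
have [n Nn ny] := lev_orbitP levl (esym ly).
have [z vz] := desc_nonempty s v.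
have : z \in desc s.+1 u.
  rewrite -(desc_univP _ univS _ _ ly); apply/descSP; exists v => //.
case/descSP=> x ux xz; rewrite -(outE x ux).
by apply: desc_block vz xz; rewrite (levS yv) (levS ux) ly.
Qed.

(** The vertices of a level share a descendant z of order s + 1, and z has only
    two in-neighbours, one of which is a descendant of order s of each of them. *)
Lemma desc_two_classes u v w : l u = l w -> l v = l w ->
  desc s u <> desc s w -> desc s v <> desc s w -> desc s u = desc s v.
Proof.
move=> lu lv neq_u neq_v; have [z wz] := desc_nonempty s.+1 w.
have uz : z \in desc s.+1 u by rewrite (desc_univP _ univS _ _ lu).
have vz : z \in desc s.+1 v by rewrite (desc_univP _ univS _ _ lv).
case/descSrP: wz => c wc cz; case/descSrP: uz => d ud dz; case/descSrP: vz => e ve ez.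
have [q [qz _ inz]] := in_other oriG cz.
have lvw : l u = l v by rewrite lv.
case: (inz d dz) => ed; first by case: neq_u; apply: desc_block ud _; rewrite ?ed.
case: (inz e ez) => ee; first by case: neq_v; apply: desc_block ve _; rewrite ?ee.
by apply: desc_block lvw ud _; rewrite ed -ee.
Qed.

Let lev_surjb (i : 'Z_r) : exists x, l x == i.
Proof. by have [x lx] := lev_surj levl i; exists x; apply/eqP. Qed.

Let rep (i : 'Z_r) : X := xchoose (lev_surjb i).

Let repE i : l (rep i) = i. Proof. exact/eqP/(xchooseP (lev_surjb i)). Qed.

(** The name, 0 or 1, of the class of v among the two classes of its level; a
    representative of each level fixes which class is called 0. *)
Definition class_bit (v : X) : 'Z_2 := ((desc s v != desc s (rep (l v))) : nat)%:R%R.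

Lemma class_bit_eq u v : l u = l v -> class_bit u = class_bit v <-> desc s u = desc s v.
Proof.
move=> lu; rewrite /class_bit lu; split=> [|->] //.
have lr : l (rep (l v)) = l v := repE _.
case: eqP => [-> | neq_u]; case: eqP => [-> | neq_v] // _.
by apply: (desc_two_classes _ _ neq_u neq_v); rewrite lr.
Qed.

Lemma out_class_bit u (b : 'Z_2) : exists2 w, a u w & class_bit w = b.
Proof.
have [w uw] := out_exists oriG u; have [w' [uw' neq_w _]] := out_other oriG uw.
have neq_h : class_bit w' <> class_bit w.
  have lw : l w' = l w by rewrite (levS uw) (levS uw').
  by case: (class_bit_eq lw) => h _ /h; apply: (desc_out_diff uw' uw neq_w).
have Z2 (c d e : 'Z_2) : d <> e -> c = d \/ c = e.
  by case: c d e => [[|[|//]] ?] [[|[|//]] ?] [[|[|//]] ?] // ne;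
     (try (by left; apply: val_inj)); try (by right; apply: val_inj);
     case: ne; apply: val_inj.
by case: (Z2 b _ _ neq_h) => ->; [exists w' | exists w].
Qed.

Let pre (v : X) : X := xchoose (in_exists oriG v).

Let preE v : a (pre v) v. Proof. exact: (xchooseP (in_exists oriG v)). Qed.

(** An arbitrary function pre chooses the ancestors; by [coords_arc] the choice
    does not affect the classes of the ancestors of order at most s. *)
Definition coords k v := [seq class_bit (iter i pre v) | i <- iota 0 k].

Lemma coordsS k v : coords k.+1 v = class_bit v :: coords k (pre v).
Proof.
rewrite /coords /= (iotaDl 1 0) -map_comp; congr (_ :: _).
by apply: eq_map => i; rewrite /= -iterSr.
Qed.

Lemma iter_desc k v : v \in desc k (iter k pre v).
Proof.
elim: k v => [|k IHk] v; first exact: set11.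
by apply/descSrP; exists (pre v); rewrite // iterSr.
Qed.

Lemma iter_lev k u v : l u = l v -> l (iter k pre u) = l (iter k pre v).
Proof.
move=> lu; apply: (@GRing.addIr _ k%:R%R).
by rewrite -!(desc_lev (iter_desc k _)).
Qed.

Lemma coords_arc k u v : k <= s -> a u v -> coords k (pre v) = coords k u.
Proof.
move=> le_ks uv; apply/eq_in_map=> i; rewrite mem_iota add0n => /= lt_ik.
have lu : l (pre v) = l u.
  by apply: (@GRing.addIr _ 1%R); rewrite -(levS uv) -(levS (preE v)).
apply/class_bit_eq; first exact: iter_lev.
apply: (desc_le (i := i.+1)); first exact: leq_trans le_ks.
apply: (desc_block (z := v)); first exact: iter_lev.
  by apply/descSrP; exists (pre v); rewrite // iter_desc.
by apply/descSrP; exists u; rewrite // iter_desc.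
Qed.

(** Start with ancestors of order s + 1, which have the same descendants of
    that order, and come down: at each step the class bit selects one of the two
    halves of the descendants. *)
Lemma coords_inj u v : l u = l v -> coords s.+1 u = coords s.+1 v -> u = v.
Proof.
move=> lu eq_c.
suff eq_d k : k <= s.+1 ->
    desc (s.+1 - k) (iter (s.+1 - k) pre u) = desc (s.+1 - k) (iter (s.+1 - k) pre v).
  by have := eq_d _ (leqnn _); rewrite subnn => /set1_inj.
elim: k => [|k IHk] lt_ks.
  by rewrite subn0; apply: (desc_univP _ univS); apply: iter_lev.
have {IHk} := IHk (ltnW lt_ks); rewrite subSS subSn //.
set j := (s - k)%N; have le_js : j <= s by apply: leq_subr.
set w := iter j pre u; set w' := iter j pre v => eq_j.
have lw : l w = l w' by apply: iter_lev.
have eq_s : desc s w = desc s w'.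
  apply/class_bit_eq => //; have /eq_in_map/(_ j) := eq_c; apply.
  by rewrite mem_iota.
have [z wz'] := desc_nonempty j w'.
have eq_p : desc j.+1 (pre w) = desc j.+1 (pre w') := eq_j.
have : z \in desc j.+1 (pre w).
  by rewrite eq_p; apply/descSP; exists w'; first exact: preE.
case/descSP=> x wx xz.
have lx : l x = l w by rewrite (levS wx) (levS (preE w)).
have eq_x : desc j x = desc j w' by apply: desc_block xz wz'; rewrite lx.
suff -> : w = x by [].
apply/eqP/idPn => neq_w; case: (desc_out_diff (preE w) wx neq_w).
by rewrite eq_s; apply: esym; apply: desc_le eq_x.
Qed.

(** Out-neighbours of a vertex have different class bits, so a walk can be
    steered to realise the prescribed bits one after the other. *)
Lemma coords_surj k (i : 'Z_r) (c : seq 'Z_2) : k <= s.+1 -> size c = k ->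
  exists2 v, l v = i & coords k v = c.
Proof.
elim: k i c => [|k IHk] i [|b c] // le_ks.
  by move=> _; exists (rep i); rewrite ?repE.
case=> size_c; have [u lu cu] := IHk (i - 1)%R c (ltnW le_ks) size_c.
have [w uw hw] := out_class_bit u b.
exists w; first by rewrite (levS uw) lu; ring.
by rewrite coordsS hw (coords_arc (k := k) le_ks uw) cu.
Qed.

Lemma coordinates_iso : graph_iso X (C2_graph r s.+1).
Proof.
have size_coords v : size (coords s.+1 v) == s.+1 by rewrite size_map size_iota.
pose f v : C2_graph r s.+1 := (l v, Tuple (size_coords v)).
have injf : injective f.
  move=> u v eq_f; apply: coords_inj; first exact: (congr1 fst eq_f).
  exact: (congr1 (fun y => tval y.2) eq_f).
have surf y : exists v, f v = y.
  case: y => i c; have [v lv cv] := coords_surj i (leqnn s.+1) (size_tuple c).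
  by exists v; congr (_, _) => //; apply: val_inj.
exists f.
  apply: (inj_card_bij injf); rewrite -(card_codom injf).
  by apply/subset_leq_card/subsetP=> y _; have [v <-] := surf y; apply: codom_f.
suff arcE u v : C2_arc (f u) (f v) = a u v by move=> u v; rewrite edgeE /= /C2_rel !arcE.
have take_coords : take s (coords s.+1 u) = coords s u.
  by rewrite -map_take take_iota (minn_idPl (leqnSn s)).
have -> : C2_arc (f u) (f v) = (l v == l u + 1)%R
    && (coords s.+1 v == head 0%R (coords s.+1 v) :: take s (coords s.+1 u)) by [].
rewrite take_coords [coords s.+1 v]coordsS /= eqseq_cons eqxx /=.
apply/andP/idP => [[/eqP lv /eqP cv] | uv]; last first.
  by rewrite (levS uv) eqxx (coords_arc _ uv).
have [w uw hw] := out_class_bit u (class_bit v).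
suff -> : v = w by [].
apply: coords_inj; first by rewrite (levS uw).
by rewrite !coordsS hw cv (coords_arc _ uw).
Qed.

End Coordinates.

Lemma elementary_iso : exists t, 1 <= t /\ graph_iso X (C2_graph r t).
Proof.
case: (ex_minnP desc_univ_exists) => -[|s] univ minS.
  have [x0 _] := lev_surj levl 0%R; have [y xy] := out_exists oriG x0.
  have [z [xz neq_z _]] := out_other oriG xy.
  have /set1_inj eq_zy : desc 0 z = desc 0 y.
    by apply: (desc_univP _ univ); rewrite (levS xy) (levS xz).
  by rewrite eq_zy eqxx in neq_z.
exists s.+1; split=> //; apply: coordinates_iso => //.
by apply/negP=> /minS; rewrite ltnn.
Qed.

End Descendants.

(** * The index of a normal subgroup in the kernel *)

Section Walks.

Variables (X : sgraph) (G : {group {perm X}}) (a : rel X).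
Hypothesis oriG : orientation G a.

(** Only the first s + 1 values of c matter: it is a directed walk with s arcs. *)
Definition walk s (c : nat -> X) := forall i, i < s -> a (c i) (c i.+1).

Definition walk_rcons s (c : nat -> X) z := fun i => if i <= s then c i else z.

Lemma walk_rconsP s c z : walk s c -> a (c s) z -> walk s.+1 (walk_rcons s c z).
Proof.
move=> wc cz i; rewrite /walk_rcons ltnS => le_is; rewrite le_is.
by case: ltnP => [/wc //| ge_is]; rewrite (_ : i = s) //; apply/eqP; rewrite eqn_leq le_is.
Qed.

Lemma walk_act g s c : g \in G -> walk s c -> walk s (fun i => g (c i)).
Proof. by move=> Gg wc i /wc; rewrite (arc_act oriG). Qed.

Definition walk_stab (H : {group {perm X}}) s (c : nat -> X) : {group {perm X}} :=
  'C_H([set c (val i) | i : 'I_s.+1] | 'P)%G.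

Lemma walk_stabP (H : {group {perm X}}) s c g :
  reflect (g \in H /\ forall i, i <= s -> g (c i) = c i) (g \in walk_stab H s c).
Proof.
apply: (iffP setIP) => -[Hg fixg]; split=> //.
  move=> i le_is; apply: (astabP fixg).
  by apply/imsetP; exists (Ordinal (le_is : i < s.+1)).
by apply/astabP=> _ /imsetP[i _ ->]; apply: fixg; rewrite -ltnS ltn_ord.
Qed.

(** Each further vertex of the walk is one of the two out-neighbours of a fixed
    vertex, so fixing it costs a factor of at most 2. *)
Lemma walk_stab_index (H : {group {perm X}}) s j c : H \subset G -> walk (s + j) c ->
  #|walk_stab H s c| <= 2 ^ j * #|walk_stab H (s + j) c|.
Proof.
move=> sHG; elim: j => [|j IHj] wc; first by rewrite addn0 mul1n.
apply: leq_trans (IHj _) _; first by move=> i lt_is; apply: wc; rewrite addnS ltnW.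
rewrite expnSr -mulnA leq_mul2l; apply/orP; right; rewrite addnS.
set S := walk_stab H (s + j) c; set w := c (s + j).+1.
rewrite -(card_orbit_stab 'P S w); apply: leq_mul.
  rewrite -(arc_out oriG (c (s + j))); apply/subset_leq_card/subsetP=> _ /orbitP[g Sg <-].
  have [Hg /(_ _ (leqnn _)) gc] := walk_stabP _ _ _ _ Sg.
  rewrite inE /= -{1}gc (arc_act oriG) ?(subsetP sHG) //.
  by apply: wc; rewrite addnS.
apply/subset_leq_card/subsetP=> g /setIP[/walk_stabP[Hg gc] /astab1P gw].
apply/walk_stabP; split=> // i; rewrite leq_eqVlt ltnS => /predU1P[-> //|].
exact: gc.
Qed.

Variables (N : {group {perm X}}) (r : nat) (l : X -> 'Z_r).
Hypotheses (nNG : N <| G) (r_gt2 : 2 < r) (levl : cyclic_level a N l).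
Hypothesis levS : forall x y, a x y -> (l y = l x + 1)%R.

Let NG n : n \in N -> n \in G. Proof. exact/subsetP/normal_sub. Qed.

Let NJ n g : n \in N -> g \in G -> n ^ g \in N.
Proof. by move=> Nn Gg; rewrite memJ_norm // (subsetP (normal_norm nNG)). Qed.

Lemma walk_lev s c i : walk s c -> i <= s -> l (c i) = (l (c 0) + i%:R)%R.
Proof.
move=> wc; elim: i => [|i IHi] lt_is; first by rewrite GRing.addr0.
by rewrite (levS (wc i lt_is)) (IHi (ltnW lt_is)) -GRing.natr1; ring.
Qed.

(** The last vertices of the fixed walks form a set closed under arcs, by
    shifting walks one step forwards. *)
Lemma walk_fix_eq1 s c (g : {perm X}) : walk s c -> (forall i, i <= s -> g (c i) = c i) ->
    (forall d z, walk s d -> (forall i, i <= s -> g (d i) = d i) ->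
       a (d s) z -> g z = z) ->
  g = 1.
Proof.
move=> wc gc stepg; apply/permP=> v; rewrite perm1.
pose P v := exists d, [/\ walk s d, d s = v & forall i, i <= s -> g (d i) = d i].
suff [d [wd dv gd]] : P v by rewrite -dv gd.
apply: (reach_ind oriG (x := c s) (P := P)) v => [|u v [d [wd du gd]] uv]; first by exists c.
rewrite -du in uv; exists (fun i => walk_rcons s d v i.+1); split.
- by move=> i lt_is; apply: (walk_rconsP wd uv).
- by rewrite /walk_rcons ltnn.
move=> i le_is; rewrite /walk_rcons; case: ifP => [lt_is | _]; first exact: gd.
exact: stepg uv.
Qed.

Definition walk_trans s := forall c d, walk s c -> walk s d -> l (c 0) = l (d 0) ->
  exists2 n, n \in N & forall i, i <= s -> n (c i) = d i.

Definition walk_free s := forall c n, walk s c -> n \in N ->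
  (forall i, i <= s -> n (c i) = c i) -> n = 1.

Lemma walk_transG s c d : walk_trans s -> walk s c -> walk s d ->
  exists2 g, g \in G & forall i, i <= s -> g (c i) = d i.
Proof.
move=> trs wc wd; have [g Gg gc] := vertex_trans oriG (c 0) (d 0).
have [|n Nn nc] := trs _ _ (walk_act Gg wc) wd; first by rewrite gc.
exists (g * n) => [|i le_is]; first by rewrite groupM // NG.
by rewrite permM nc.
Qed.

(** All walks with s arcs are conjugate under G, so the property of c, that its
    stabiliser in N also fixes the next vertices, holds for all of them. *)
Lemma walk_trans_free s c w : walk_trans s -> walk s c -> a (c s) w ->
    (forall n, n \in walk_stab N s c -> n w = w) ->
  forall n, n \in walk_stab N s c -> n = 1.
Proof.
move=> trs wc cw fixw n /walk_stabP[Nn nc].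
apply: walk_fix_eq1 (wc) (nc) _ => d z wd nd dz.
have [g Gg gc] := walk_transG trs wc wd.
have fixg : n ^ g^-1 \in walk_stab N s c.
  apply/walk_stabP; split=> [|i le_is]; first by rewrite NJ ?groupV.
  by rewrite -[c i](permK g) gc // permJ nd.
have ngw : n (g w) = g w.
  apply: (@perm_inj _ g^-1); rewrite -permJ -[X in _ = X]/(g^-1 (g w)) permK.
  exact: fixw.
have dgw : a (d s) (g w) by rewrite -gc // (arc_act oriG).
exact: out_fix (NG Nn) (nd _ (leqnn _)) dgw ngw dz.
Qed.

(** A conjugate of n0 swaps the two continuations of any given walk. *)
Lemma walk_trans_succ s c w n0 : walk_trans s -> walk s c -> a (c s) w ->
  n0 \in walk_stab N s c -> n0 w <> w -> walk_trans s.+1.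
Proof.
move=> trs wc cw /walk_stabP[Nn0 n0c] n0w d e wd we lde.
have wd' : walk s d by move=> i lt_is; apply/wd/ltnW.
have we' : walk s e by move=> i lt_is; apply/we/ltnW.
have [n Nn nd] := trs _ _ wd' we' lde.
suff [m [Nm me mn]] : exists m,
    [/\ m \in N, forall i, i <= s -> m (e i) = e i & m (n (d s.+1)) = e s.+1].
  exists (n * m) => [|i]; first by rewrite groupM.
  rewrite leq_eqVlt ltnS permM => /predU1P[-> // | le_is].
  by rewrite nd // me.
have nds : a (e s) (n (d s.+1)) by rewrite -nd // (arc_act oriG) ?NG //; apply: wd.
have es : a (e s) (e s.+1) by apply: we.
have [eq_n | neq_n] := eqVneq (n (d s.+1)) (e s.+1).
  by exists 1; split=> [|i _|]; rewrite ?group1 ?perm1.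
have [g Gg gc] := walk_transG trs wc we'.
have me i : i <= s -> (n0 ^ g) (e i) = e i.
  by move=> le_is; rewrite -gc // permJ n0c.
exists (n0 ^ g); split=> //; first exact: NJ.
have ms : a (e s) ((n0 ^ g) (n (d s.+1))).
  by rewrite -{1}(me s) // (arc_act oriG) // NG ?NJ.
have [z [_ _ outE]] := out_other oriG nds.
have [eq_m | ->] := outE _ ms; last by case: (outE _ es) => // eq_e; rewrite eq_e eqxx in neq_n.
case: n0w; apply: (@perm_inj _ g); rewrite -permJ.
apply: (out_fix oriG (NG (NJ Nn0 Gg)) (me s (leqnn s)) nds eq_m).
by rewrite -gc // (arc_act oriG).
Qed.

(** Prolong a walk as long as its stabiliser in N moves a next vertex: N stays
    transitive on the walks issued from a level, and the stabiliser shrinks. *)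
Lemma regular_walks : exists s, walk_trans s /\ walk_free s.
Proof.
suff key m s c : walk s c -> walk_trans s -> #|walk_stab N s c| <= m ->
    exists s, walk_trans s /\ walk_free s.
  have [x _] := lev_surj levl 0%R.
  apply: (key _ 0%N (fun=> x)) (leqnn _) => // c d _ _ /(lev_orbitP levl)[n Nn nc].
  by exists n => // i; rewrite leqn0 => /eqP->.
elim: m s c => [|m IHm] s c wc trs; first by rewrite leqNgt cardG_gt0.
move=> le_m; have [w cw] := out_exists oriG (c s).
have [/forall_inP fixw | /forall_inPn[n0 Sn0 n0w]] :=
    boolP [forall n in walk_stab N s c, n w == w].
  have stab1 := walk_trans_free trs wc cw (fun n Sn => eqP (fixw n Sn)).
  exists s; split=> // d n wd Nn nd; have [g Gg gc] := walk_transG trs wc wd.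
  apply: (conjg_inj g^-1); rewrite conj1g; apply: stab1.
  apply/walk_stabP; split=> [|i le_is]; first by rewrite NJ ?groupV.
  by rewrite -[c i](permK g) gc // permJ nd.
have n0w' := elimN eqP n0w.
apply: (IHm s.+1 (walk_rcons s c w)); first exact: walk_rconsP.
  exact: walk_trans_succ trs wc cw Sn0 n0w'.
rewrite -ltnS (leq_trans _ le_m) //; apply/proper_card/properP; split.
  apply/subsetP=> n /walk_stabP[Nn nc]; apply/walk_stabP; split=> // i le_is.
  by have := nc i (leqW le_is); rewrite /walk_rcons le_is.
exists n0 => //; apply/negP=> /walk_stabP[_ /(_ _ (leqnn _))].
by rewrite /walk_rcons ltnn.
Qed.

(** For a walk d fixed by x, let n in N carry to d the part of c that starts on
    the level of d. As N is regular on walks, x and n commute; since x fixes the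
    vertex of c that comes next, it fixes the image of this vertex under n, which
    is an out-neighbour of the end of d. *)
Lemma long_walk_fix s c x : walk_free s -> walk_trans s -> walk (s + r) c ->
  x \in G -> (forall i, i <= s + r -> x (c i) = c i) -> x = 1.
Proof.
move=> frees trs wc Gx xc.
apply: (walk_fix_eq1 (s := s) (c := c)).
- by move=> i lt_is; apply: wc; rewrite ltn_addr.
- by move=> i le_is; apply: xc; rewrite (leq_trans le_is) ?leq_addr.
move=> d z wd xd dz; pose j : nat := (l (d 0) - l (c 0))%R.
have lt_jr : j < r by rewrite -[X in _ < X](Zp_cast (ltnW r_gt2)) ltn_ord.
have le_js i : i <= s -> j + i < s + r.
  by move=> le_is; rewrite -addSn [(s + r)%N]addnC leq_add.
have wj : walk s (fun i => c (j + i)%N).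
  by move=> i lt_is; rewrite addnS; apply/wc/le_js/ltnW.
have lj : l (c (j + 0)%N) = l (d 0).
  rewrite addn0 (walk_lev wc); last by rewrite -[j]addn0 ltnW ?le_js.
  by rewrite natr_Zp; ring.
have [n Nn nc] := trs _ _ wj wd lj.
have xVc i : i <= s + r -> x^-1 (c i) = c i by move=> le_i; rewrite -{1}xc // permK.
have nx : n ^ x^-1 = n.
  suff /eqP : n * (n^-1 ^ x^-1) = 1 by rewrite conjVg -eq_mulgV1 => /eqP <-.
  apply: (frees _ _ wj) => [|i le_is].
    by rewrite groupM ?NJ ?groupV.
  have xVd : x^-1 (d i) = d i by rewrite -{1}xd // permK.
  by rewrite permM nc // -{1}xVd permJ -nc // permK xVc // ltnW ?le_js.
have cw : a (c (j + s)%N) (c (j + s).+1) by apply/wc/le_js.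
have dw : a (d s) (n (c (j + s).+1)) by rewrite -nc // (arc_act oriG) ?NG.
apply: (out_fix oriG Gx (xd s (leqnn s)) dw _ dz).
by apply: (canLR (permKV x)); rewrite -{1}nx -{1}(xVc (j + s).+1) ?le_js // permJ.
Qed.

(** Let N be regular on walks with s arcs issued from a level. The kernel is the
    product of N and the stabiliser of such a walk, which acts faithfully on the
    prolongations of this walk by r arcs. *)
Lemma kernel_card : #|nq_kernel G N| <= #|N| * 2 ^ r.
Proof.
have [s [trs frees]] := regular_walks.
have [x0 _] := lev_surj levl 0%R.
pose f x := xchoose (out_exists oriG x).
have wc m : walk m (fun i => iter i f x0).
  by move=> i _; apply: (xchooseP (out_exists oriG _)).
set c := fun i => iter i f x0 in wc.
set K := nq_kernel G N; have sKG : K \subset G by apply: subsetIl.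
have oKc : #|walk_stab K s c| <= 2 ^ r.
  apply: leq_trans (walk_stab_index (j := r) sKG (wc _)) _.
  rewrite -[X in _ <= X]muln1 leq_mul2l -(cards1 (1 : {perm X})).
  apply/orP; right; apply/subset_leq_card/subsetP=> x /walk_stabP[Kx xc].
  by rewrite inE; apply/eqP/(long_walk_fix frees trs (wc _) _ xc)/(subsetP sKG).
have sK : K \subset walk_stab K s c * N.
  apply/subsetP=> k Kk; have [Gk lk] := lev_kernelP nNG levl _ Kk.
  have [|n Nn nc] := trs c _ (wc s) (walk_act Gk (wc s)); first by rewrite lk.
  apply/mulsgP; exists (k * n^-1) n; rewrite ?mulgKV //.
  apply/walk_stabP; split=> [|i le_is].
    by rewrite groupM ?groupV // (subsetP (nq_kernel_sub nNG)).
  by rewrite permM -nc // permK.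
apply: leq_trans (subset_leq_card sK) _.
apply: leq_trans (dvdn_leq _ (dvdn_cardMg _ _)) _; first by rewrite muln_gt0 !cardG_gt0.
by rewrite mulnC leq_mul2l oKc orbT.
Qed.

End Walks.

(** * The least cyclic kernel and quotients with at most two vertices *)

(** The quotients of y by its other conjugates generate a normal subgroup. It is
    N, or it is trivial and then y is central and generates N. *)
Lemma minnormal_class_grank (gT : finGroupType) (G N : {group gT}) y :
  minnormal N G -> y \in N -> y != 1 -> 'm(N) <= maxn 1 #|y ^: G|.-1.
Proof.
case/mingroupP=> /andP[ntN nNG] minN Ny nty.
pose S := [set y * z^-1 | z in (y ^: G) :\ y].
have NyG z : z \in y ^: G -> z \in N.
  by case/imsetP=> g Gg ->; rewrite memJ_norm // (subsetP nNG).
have Sz z : z \in y ^: G -> y * z^-1 \in <<S>>.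
  have [-> _|neq_zy yz] := eqVneq z y; first by rewrite mulgV group1.
  by rewrite mem_gen //; apply: imset_f; rewrite !inE neq_zy.
have sSN : <<S>> \subset N.
  rewrite gen_subG; apply/subsetP=> _ /imsetP[z /setD1P[_ /NyG Nz] ->].
  by rewrite groupM ?groupV.
have nSG : G \subset 'N(<<S>>).
  apply/subsetP=> g Gg; rewrite inE -genJ gen_subG.
  apply/subsetP=> _ /imsetP[_ /imsetP[z /setD1P[_ yz] ->] ->].
  have -> : (y * z^-1) ^ g = (y * (y ^ g)^-1)^-1 * (y * (z ^ g)^-1).
    by rewrite conjMg conjVg [(y * _^-1)^-1]invMg invgK mulgA mulgKV.
  rewrite groupM ?groupV ?Sz ?memJ_class //.
  by case/imsetP: yz => h Gh ->; rewrite -conjgM memJ_class ?groupM.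
have [S1 | ntS] := eqVneq <<S>> 1.
  have cent_y g : g \in G -> y ^ g = y.
    move=> Gg; have := Sz _ (memJ_class y Gg); rewrite S1 => /set1P/eqP.
    by rewrite -eq_mulgV1 => /eqP <-.
  have defN : <[y]> = N.
    apply: minN; rewrite ?cycle_subG // cycle_eq1 nty /=.
    apply: cents_norm; rewrite cent_cycle; apply/subsetP=> g Gg.
    by apply/cent1P/commute_sym/commgP/conjg_fixP; rewrite cent_y.
  by rewrite -defN (leq_trans (grank_min _)) // cards1 leq_max.
have defN : <<S>> = N by apply: (minN <<S>>%G); rewrite //= ntS nSG.
rewrite -defN (leq_trans (grank_min _)) // leq_max; apply/orP; right.
apply: leq_trans (leq_imset_card _ _) _.
by rewrite (cardsD1 y (y ^: G)) class_refl.
Qed.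

Lemma simple_abelem_card (gT : finGroupType) (p : nat) (N T : {group gT}) :
  p.-abelem N -> T \subset N -> simple T -> #|T| = p.
Proof.
move=> abelN sTN simT; have abT := abelianS sTN (abelem_abelian abelN).
have /(pgroupP (pgroupS sTN (abelem_pgroup abelN))) := simple_sol_prime (abelian_sol abT) simT.
by move/(_ (dvdnn _))/eqP.
Qed.

Section Quotients.

Variables (X : sgraph) (G : {group {perm X}}).
Implicit Types M N : {group {perm X}}.

(** The length of the cycle is forced to be the number of vertices, which makes
    the property decidable. *)
Definition is_cycleb (Y : sgraph) := (2 < #|Y|) &&
  [exists f : {ffun Y -> 'Z_#|Y|}, injectiveb f &&
    [forall x, forall y, @sedge (Cn #|Y|) (f x) (f y) == sedge x y]].

Lemma is_cycleP (Y : sgraph) : reflect (is_cycle Y) (is_cycleb Y).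
Proof.
apply: (iffP andP) => [[Y_gt2 /existsP[f /andP[/injectiveP injf /forallP fE]]] |].
  exists #|Y| => //; exists f; last first.
    by move=> x y; have /forallP/(_ y)/eqP := fE x.
  by apply: (inj_card_bij injf); rewrite /= card_ord Zp_cast // ltnW.
case=> r r_gt2 [f bijf fE]; have oY : #|Y| = r.
  by rewrite (bij_eq_card bijf) /= card_ord Zp_cast // ltnW.
rewrite oY; split=> //; apply/existsP; exists [ffun x => f x : 'Z_r].
apply/andP; split.
  by apply/injectiveP=> x y; rewrite !ffunE; apply: (bij_inj bijf).
by apply/forallP=> x; apply/forallP=> y; rewrite !ffunE; apply/eqP/fE.
Qed.

(** As no two cyclic quotients are independent, the intersection of two kernels
    defines a cyclic quotient again, so a kernel of smallest order is contained in all others. *)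
Lemma least_cyclic_kernel : cycle_type G -> ~ has_independent_nq G ->
  exists2 M, cyclic_nq G M &
    forall N, cyclic_nq G N -> nq_kernel G M \subset nq_kernel G N.
Proof.
move=> [N0 cycN0] noind.
pose P N := (N <| G) && is_cycleb (normal_quotient N).
have cycP N : reflect (cyclic_nq G N) (P N).
  by apply: (iffP andP) => -[nNG /is_cycleP].
have PN0 : P N0 by apply/cycP.
case: (arg_minnP (fun N : {group {perm X}} => #|nq_kernel G N|) PN0) => M /cycP cycM minM.
exists M => // N cycN; have [nMG nNG] := (cycM.1, cycN.1).
pose L := (nq_kernel G M :&: nq_kernel G N)%G.
have nLG : L <| G by apply: normalI; apply: nq_kernel_normal.
have cycL : cyclic_nq G L.
  split=> //; apply/is_cycleP/idPn => ncyc; apply: noind; exists M, N.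
  by split=> //; apply/is_cycleP.
have sLM : nq_kernel G L \subset nq_kernel G M :&: nq_kernel G N.
  apply/subsetP=> k /(nq_kernelP _ nLG)[Gk ok].
  rewrite inE; apply/andP; split; apply/nq_kernelP=> //; split=> // x.
    rewrite -(nq_kernel_orbit x nMG); case/orbitP: (ok x) => n /setIP[Kn _] <-.
    exact: mem_orbit.
  rewrite -(nq_kernel_orbit x nNG); case/orbitP: (ok x) => n /setIP[_ Kn] <-.
  exact: mem_orbit.
have /eqP defM : nq_kernel G L == nq_kernel G M :> {set _}.
  rewrite eqEcard (subset_trans sLM (subsetIl _ _)).
  by apply: minM; apply/cycP.
by rewrite -defM (subset_trans sLM) ?subsetIr.
Qed.

Lemma degenerate_cases N : degenerate (normal_quotient N) ->
  is_cycle (normal_quotient N) \/ #|orbits_of N| <= 2.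
Proof.
have oQ : #|normal_quotient N| = #|orbits_of N| by rewrite /= card_sig.
case=> [[f bijf _] | [f bijf _] | cycN]; [right | right | by left].
  by rewrite -oQ (bij_eq_card bijf) /= card_ord.
by rewrite -oQ (bij_eq_card bijf) /= card_ord.
Qed.

Lemma few_orbits N (u v w : X) : #|orbits_of N| <= 2 ->
  v \notin orbit 'P N u -> w \notin orbit 'P N u -> w \in orbit 'P N v.
Proof.
move=> o2 nuv nuw; apply: contraLR o2 => nvw; rewrite -ltnNge.
pose S := [set orbit 'P N u; orbit 'P N v; orbit 'P N w].
have neq x y : y \notin orbit 'P N x -> orbit 'P N x != orbit 'P N y.
  by apply: contraNneq => ->; apply: orbit_refl.
have oS : #|S| = 3.
  rewrite /S setUC cardsU1 cards2 neq // !inE negb_or.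
  by rewrite ![orbit 'P N w == _]eq_sym !neq.
rewrite -oS; apply/subset_leq_card/subsetP=> B.
by rewrite !inE -orbA => /or3P[] /eqP->; apply: imset_f.
Qed.

Lemma few_orbits_card N : #|orbits_of N| <= 2 -> #|X| <= 2 * #|N|.
Proof.
move=> o2; have oN (x : X) : #|orbit 'P N x| <= #|N| by apply: leq_imset_card.
have [u _ | no_u] := pickP (@predT X); last by rewrite (eq_card0 (A := X)).
have [w nuw | all_u] := pickP [pred w | w \notin orbit 'P N u].
  apply: leq_trans (_ : #|orbit 'P N u :|: orbit 'P N w| <= _); last first.
    by rewrite cardsU (leq_trans (leq_subr _ _)) // mul2n -addnn leq_add.
  apply/subset_leq_card/subsetP=> x _; rewrite inE.
  by case: (boolP (x \in orbit 'P N u)) => //= nux; apply: few_orbits o2 nuw nux.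
apply: leq_trans (_ : #|orbit 'P N u| <= _); last by rewrite (leq_trans (oN u)) // leq_pmull.
apply/subset_leq_card/subsetP=> x _.
by have := all_u x; rewrite /= => /negbFE.
Qed.

End Quotients.

(** * Minimal normal subgroups *)

Section MinimalNormal.

Variables (gT : finGroupType) (G : {group gT}).
Implicit Types M N : {group gT}.

Lemma minimal_normalP N : minimal_normal G N ->
  [/\ N <| G, N :!=: 1 & forall M, M <| G -> M \subset N -> M :!=: 1 -> N \subset M].
Proof.
case/andP=> sNG /mingroupP[/andP[ntN nNG] minN]; split=> //.
  by apply/andP.
move=> M /andP[_ nMG] sMN ntM.
by rewrite -(minN M) // ntM nMG.
Qed.

Lemma minimal_normal_sub_or_TI N M : minimal_normal G N -> M <| G ->
  N \subset M \/ N :&: M = 1.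
Proof.
case/minimal_normalP=> nNG _ minN nMG; have [|ntI] := eqVneq (N :&: M) 1; [by right | left].
have := minN (N :&: M)%G; rewrite normalI // subsetIl => /(_ isT isT ntI) sNI.
exact: subset_trans sNI (subsetIr _ _).
Qed.

Lemma minimal_normal_TI N M : minimal_normal G N -> minimal_normal G M ->
  N :!=: M -> N :&: M = 1.
Proof.
move=> minN minM neq; have [nNG ntN _] := minimal_normalP minN.
have [nMG _ minM'] := minimal_normalP minM.
have [sNM|//] := minimal_normal_sub_or_TI minN nMG.
by case/eqP: neq; apply/eqP; rewrite eqEsubset sNM minM'.
Qed.

Lemma normal_TI_commute N M n m : N <| G -> M <| G -> N :&: M = 1 ->
  n \in N -> m \in M -> commute n m.
Proof.
move=> nNG nMG tiNM Nn Mm; suff /centsP : N \subset 'C(M) by apply.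
apply/commG1P/trivgP; rewrite -tiNM subsetI commg_subl commg_subr.
by rewrite (subset_trans (normal_sub nMG) (normal_norm nNG))
           (subset_trans (normal_sub nNG) (normal_norm nMG)).
Qed.

Lemma minimal_normal_exists (M : {group gT}) : M <| G -> M :!=: 1 ->
  exists2 N, minimal_normal G N & N \subset M.
Proof.
move=> nMG ntM; have [N minN sNM] := minnormal_exists ntM (normal_norm nMG).
by exists N; rewrite // /minimal_normal minN (subset_trans sNM) ?normal_sub.
Qed.

Lemma soc_pgroup (p : nat) :
  (forall N, minimal_normal G N -> p.-group N) -> p.-group (soc G).
Proof.
move=> pN; apply: pgroupS (pcore_pgroup p G).
rewrite gen_subG; apply/bigcupsP=> N minN; apply: pcore_max; first exact: pN.
by have [] := minimal_normalP minN.
Qed.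

(** The factor T is normalised by N, so it has at most as many conjugates as
    the index of N, and their number bounds k by comparing orders. *)
Lemma minimal_normal_factor N : minimal_normal G N ->
  exists (T : {group gT}) (k : nat),
    [/\ 1 <= k, simple T /\ T \subset N, N \isog gpower T k,
        #|N| = (#|T| ^ k)%N & k <= #|G : N|].
Proof.
move=> minN; have [nNG _ _] := minimal_normalP minN; case/andP: minN => _ minN.
have [T [k [k_gt0 simT [sTN nTN] isoN oN]]] := minnormal_gpower minN.
exists T, k; split=> //; have ntT : T :!=: 1 by case/simpleP: simT.
have := minnormal_card_conjugates minN sTN ntT nTN.
rewrite oN leq_exp2l ?cardG_gt1 // => le_k; apply: leq_trans le_k _.
by rewrite dvdn_leq // indexgS // subsetI normal_sub.
Qed.

Lemma abelian_minimal_normal N : minimal_normal G N -> abelian N ->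
  exists2 p, prime p & p.-abelem N.
Proof.
case/andP=> sNG minN abN; have [] := minnormal_solvable minN (subxx _) (abelian_sol abN).
by move=> _ _ /is_abelemP.
Qed.

End MinimalNormal.

Section Pair.

Variables (X : sgraph) (G : {group {perm X}}) (a : rel X).
Hypothesis oriG : orientation G a.
Hypothesis edgeE : forall x y : X, sedge x y = a x y || a y x.
Hypothesis basicG : basic_pair G.
Variable N0 : {group {perm X}}.
Hypothesis cycN0 : cyclic_nq G N0.
Hypothesis leastN0 : forall N, cyclic_nq G N -> nq_kernel G N0 \subset nq_kernel G N.
Implicit Types M N : {group {perm X}}.

Let K := nq_kernel G N0.

Lemma cyclic_nq_level N : cyclic_nq G N ->
  exists r (l : X -> 'Z_r), [/\ 2 < r, graph_iso (normal_quotient N) (Cn r) & cyclic_level a N l].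
Proof.
case=> nNG [r r_gt2 isoN]; have [l levl] := cyclic_level_exists oriG edgeE nNG r_gt2 isoN.
by exists r, l.
Qed.

(** Along two arcs, a vertex can be returned to its own N0-orbit when N0 is of
    unoriented type; this is impossible if each arc raises the level by one for
    N, since r > 2. *)
Lemma out_same_least N : cyclic_nq G N -> out_same a N = out_same a N0.
Proof.
move=> cycN; have nNG := cycN.1; have sKN := leastN0 cycN.
have nN0G := cycN0.1.
have sub x y : y \in orbit 'P N0 x -> y \in orbit 'P N x.
  rewrite -(nq_kernel_orbit x nN0G) -(nq_kernel_orbit x nNG) => /orbitP[k Kk <-].
  exact/mem_orbit/(subsetP sKN).
apply/idP/idP => [sameN | /out_sameP same0]; last first.
  by apply/out_sameP=> x y z xy xz; apply: sub; apply: same0 xz.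
apply/idPn => split0.
have [r [l [r_gt2 _ levl]]] := cyclic_nq_level cycN.
have [l' levl' levS] := oriented_level oriG nNG r_gt2 levl sameN.
have [r0 [l0 [r0_gt2 _ levl0]]] := cyclic_nq_level cycN0.
have [x _] := lev_surj levl0 0%R.
have [y [_ [xy _ ly _]]] := unoriented_out oriG nN0G levl0 split0 x.
have [_ [w [_ yw _ lw]]] := unoriented_out oriG nN0G levl0 split0 y.
have : w \in orbit 'P N x.
  apply: sub; rewrite -(lev_orbit levl0); apply/eqP.
  by apply: (@GRing.addIr _ 1%R); rewrite -lw.
rewrite -(lev_orbit levl') (levS _ _ yw) (levS _ _ xy) eq_sym.
by rewrite Zp_add2_neq.
Qed.

(** The orbits of N are contained in at least three levels, which rules out the
    other degenerate quotients. *)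
Lemma sub_kernel_cyclic N : N <| G -> N :!=: 1 -> N \subset K -> cyclic_nq G N.
Proof.
move=> nNG ntN sNK; split=> //; have [//|o2] := degenerate_cases (basicG nNG ntN).
have [r0 [l0 [r0_gt2 _ levl0]]] := cyclic_nq_level cycN0.
have nlev x y : l0 x != l0 y -> y \notin orbit 'P N x.
  apply: contra => /orbitP[n /(subsetP sNK) /(lev_kernelP cycN0.1 levl0)[_ ln] <-].
  by rewrite -(ln x).
have [x lx] := lev_surj levl0 0%R; have [y ly] := lev_surj levl0 1%R.
have [z lz] := lev_surj levl0 (1 + 1)%R.
have nxy : y \notin orbit 'P N x by apply: nlev; rewrite lx ly eq_sym GRing.oner_neq0.
have nyz : z \notin orbit 'P N y by apply: nlev; rewrite ly lz Zp_succ_neq.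
have nxz : z \notin orbit 'P N x.
  by apply: nlev; rewrite lx lz eq_sym -[(1 + 1)%R]GRing.add0r GRing.addrA Zp_add2_neq.
by rewrite (few_orbits o2 nxy nxz) in nyz.
Qed.

Lemma kernel_normal : K <| G. Proof. exact: nq_kernel_normal cycN0.1. Qed.

Section OrientedCase.

Hypothesis same0 : out_same a N0.

Lemma oriented_cyclic N : cyclic_nq G N -> oriented_nq G N.
Proof.
move=> cycN; have [r [l [r_gt2 isoN levl]]] := cyclic_nq_level cycN.
have sameN : out_same a N by rewrite out_same_least.
have [l' levl' levS] := oriented_level oriG cycN.1 r_gt2 levl sameN.
by exists r => //; split=> //; apply: (oriented_isog oriG cycN.1 r_gt2 levl' levS).
Qed.

Lemma oriented_stab_kernel g x : g \in G -> g x = x -> g \in K.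
Proof.
have [r [l [r_gt2 _ levl]]] := cyclic_nq_level cycN0.
have [l' levl' levS] := oriented_level oriG cycN0.1 r_gt2 levl same0.
by move=> Gg gx; apply: (lev_rot_kernel oriG cycN0.1 levl' levS (x := x)) => //; rewrite gx.
Qed.

Lemma oriented_kernel_nontriv : K :!=: 1.
Proof.
have [r [l [r_gt2 _ levl]]] := cyclic_nq_level cycN0.
have [x _] := lev_surj levl 0%R; have [y xy] := out_exists oriG x.
have [z [xz neq_zy _]] := out_other oriG xy.
have [g [Gg gx gy]] := out_swap oriG xy xz.
apply/trivgPn; exists g; first exact: oriented_stab_kernel gx.
by apply: contraNneq neq_zy => g1; rewrite -gy g1 perm1.
Qed.

(** Suppose that N meets K trivially, so that they commute, and let g swap the
    out-neighbours w and w' of v. Then g lies in K. The vertices w and w' lie in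
    one N-orbit: K preserves N-orbits if the quotient by N is a cycle; if there
    are at most two orbits, g fixes the orbit of v pointwise, so w and w' lie in
    the other one. An element of N carrying w to w' keeps their common level, so
    it is in K and trivial. *)
Lemma oriented_minimal_sub N : minimal_normal G N -> N \subset K.
Proof.
move=> minN; have [nNG ntN _] := minimal_normalP minN.
have [//|tiNK] := minimal_normal_sub_or_TI minN kernel_normal.
have [r [l [r_gt2 _ levl]]] := cyclic_nq_level cycN0.
have [l' levl' levS] := oriented_level oriG cycN0.1 r_gt2 levl same0.
have [v _] := lev_surj levl 0%R; have [w vw] := out_exists oriG v.
have [w' [vw' neq_w _]] := out_other oriG vw.
have [g [Gg gv gw]] := out_swap oriG vw vw'.
have Kg : g \in K by apply: oriented_stab_kernel gv.
have ow : w' \in orbit 'P N w.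
  have [cycN | o2] := degenerate_cases (basicG nNG ntN).
    have /subsetP/(_ g Kg)/(nq_kernelP _ nNG)[_] := leastN0 (conj nNG cycN).
    by move/(_ w); rewrite gw.
  have nov u : g u != u -> u \notin orbit 'P N v.
    apply: contra => /orbitP[n Nn <-]; rewrite /= apermE -permM.
    by rewrite (normal_TI_commute nNG kernel_normal tiNK Nn Kg) permM gv.
  apply: (few_orbits o2 (nov w _) (nov w' _)); first by rewrite gw.
  by rewrite -gw (inj_eq perm_inj) gw.
case/orbitP: ow => n Nn /= nw; case/eqP: neq_w.
suff n1 : n = 1 by rewrite -nw n1 apermE perm1.
apply/set1P; rewrite -[[set 1]]tiNK inE Nn.
apply: (lev_rot_kernel oriG cycN0.1 levl' levS (x := w)).
  exact: subsetP (normal_sub nNG) n Nn.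
by rewrite -[n w]/(aperm w n) nw (levS _ _ vw) (levS _ _ vw').
Qed.

Lemma oriented_minimal_cyclic N : minimal_normal G N -> cyclic_nq G N.
Proof.
move=> minN; have [nNG ntN _] := minimal_normalP minN.
by apply: sub_kernel_cyclic; rewrite ?oriented_minimal_sub.
Qed.

(** M and N have the same orbits, so the order of M divides that of a vertex
    stabiliser in the product M N, which is a 2-group. *)
Lemma oriented_two_minimal M N : minimal_normal G M -> minimal_normal G N ->
  N :!=: M -> 2.-group M.
Proof.
move=> minM minN neqNM; have tiNM := minimal_normal_TI minN minM neqNM.
have [nMG _ _] := minimal_normalP minM; have [nNG _ _] := minimal_normalP minN.
have cycN := oriented_minimal_cyclic minN.
have sMK : M \subset nq_kernel G N.
  exact: subset_trans (oriented_minimal_sub minM) (leastN0 cycN).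
have [r [l [r_gt2 _ levl]]] := cyclic_nq_level cycN0.
have [v _] := lev_surj levl 0%R.
have orbNM : orbit 'P (N <*> M) v = orbit 'P N v.
  apply/eqP; rewrite eqEsubset; apply/andP; split; apply/subsetP=> u /orbitP[n Nn <-].
    rewrite -(nq_kernel_orbit v nNG); apply: mem_orbit; move: n Nn; apply/subsetP.
    by rewrite join_subG nq_kernel_sub // sMK.
  by apply: mem_orbit; move: n Nn; apply/subsetP/joing_subl.
have oNM : #|N <*> M| = (#|N| * #|M|)%N.
  rewrite norm_joinEr ?TI_cardMg // (subset_trans (normal_sub nMG)) //.
  exact: normal_norm.
have stab2 : 2.-group 'C_(N <*> M)[v | 'P].
  apply: (stab_2group oriG (x := v)).
    by apply: subset_trans (subsetIl _ _) _; rewrite join_subG !normal_sub.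
  by move=> h /setIP[_ /astab1P].
apply: pnat_dvd stab2.
rewrite -(dvdn_pmul2l (cardG_gt0 N)) -oNM -(card_orbit_stab 'P (N <*> M)%G v) orbNM.
by rewrite dvdn_pmul2r ?cardG_gt0 // -(card_orbit_stab 'P N v) dvdn_mulr.
Qed.

(** N is semiregular, because its order is odd. The element d of N that carries
    w to w' spans a subgroup normalised by the kernel: a conjugate of d
    under the kernel carries one out-neighbour of some vertex on the level of v to
    the other; up to inversion so does d, since N is abelian and transitive on
    this level. Hence the subgroup has at most r conjugates. *)
Lemma oriented_abelian_bound N r (l : X -> 'Z_r) : minimal_normal G N -> abelian N ->
    ~~ 2.-group N -> 2 < r -> cyclic_level a N l ->
    (forall x y, a x y -> l y = l x + 1)%R ->
  exists p, [/\ prime p, p.-abelem N & #|N| <= p ^ r].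
Proof.
move=> minN abN n2N r_gt2 levl levS; have [p p_pr abelN] := abelian_minimal_normal minN abN.
exists p; split=> //; have [nNG ntN _] := minimal_normalP minN.
have NG n : n \in N -> n \in G by apply/subsetP/normal_sub.
have freeN n x : n \in N -> n x = x -> n = 1.
  move=> Nn nx; have s2 : 2.-group <[n]>.
    apply: (stab_2group oriG (x := x)); first by rewrite cycle_subG NG.
    by move=> h; apply: cycle_fix.
  apply/eqP; apply: contraR n2N => ntn.
  have on := abelem_order_p abelN Nn ntn.
  have p2 : p = 2 by apply/eqP; move/pgroupP: s2; apply; rewrite // -orderE on.
  by rewrite -p2 abelem_pgroup.
have [v _] := lev_surj levl 0%R; have [w vw] := out_exists oriG v.
have [w' [vw' neq_w outv]] := out_other oriG vw.
have [d Nd dw] : exists2 d, d \in N & d w = w'.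
  by apply: (lev_orbitP levl); rewrite (levS _ _ vw) (levS _ _ vw').
have ntd : d != 1 by apply: contraNneq neq_w => d1; rewrite -dw d1 perm1.
have od := abelem_order_p abelN Nd ntd.
have nKd : nq_kernel G N \subset 'N(<[d]>).
  apply/subsetP=> k Kk; have Gk : k \in G by case/(nq_kernelP _ nNG): Kk.
  have [n Nn nv] := nq_kernel_act v nNG Kk.
  have Ndk : d ^ k \in N by rewrite memJ_norm // (subsetP (normal_norm nNG)).
  have com m x : m \in N -> n (m x) = m (n x).
    by move=> Nm; rewrite -!permM (centsP abN _ Nn).
  have outnv u : a (k v) u -> u = n w \/ u = n w'.
    rewrite -nv => nvu; have nvu' : a v (n^-1 u) by rewrite -(arc_act oriG _ _ (NG n Nn)) permKV.
    by case: (outv _ nvu') => <-; rewrite permKV; [left | right].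
  have kw : a (k v) (k w) by rewrite (arc_act oriG).
  have kw' : a (k v) (k w') by rewrite (arc_act oriG).
  have dk : (d ^ k) (k w) = k w' by rewrite permJ dw.
  have nw : d (n w) = n w' by rewrite -com // dw.
  suff dkE : d ^ k = d \/ d ^ k = d^-1.
    by rewrite inE -cycleJ cycle_subG; case: dkE => ->; rewrite ?groupV cycle_id.
  have [[ekw | ekw] [ekw' | ekw']] := (outnv _ kw, outnv _ kw').
  - by case/eqP: neq_w; apply: (@perm_inj _ k); rewrite ekw ekw'.
  - left; apply/eqP; rewrite eq_mulgV1; apply/eqP/(freeN _ (n w)).
      by rewrite groupM ?groupV.
    by rewrite permM -ekw dk ekw' -nw permK.
  - right; apply/eqP; rewrite -(inj_eq (mulIg d)) mulVg; apply/eqP/(freeN _ (n w')).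
      by rewrite groupM.
    by rewrite permM -{1}ekw dk ekw' nw.
  by case/eqP: neq_w; apply: (@perm_inj _ k); rewrite ekw ekw'.
have sdN : <[d]> \subset N by rewrite cycle_subG.
have minN' : minnormal N G by case/andP: minN.
have nNd : N \subset 'N(<[d]>).
  by apply/cents_norm; rewrite cent_cycle -cent_set1 centsC sub1set (subsetP abN).
have ntD : <[d]> :!=: 1 by rewrite cycle_eq1.
have := minnormal_card_conjugates minN' sdN ntD nNd; rewrite -orderE od => le_N.
apply: leq_trans le_N _; rewrite leq_exp2l ?prime_gt1 //.
have iK := oriented_index oriG nNG r_gt2 levl levS.
rewrite -[X in _ <= X]iK dvdn_leq // indexgS // subsetI nKd andbT.
exact: normal_sub (nq_kernel_normal nNG).
Qed.

Lemma oriented_conclusion :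
  (2.-group (soc G) /\
     exists r t : nat, [/\ 3 <= r, 1 <= t & graph_iso X (C2_graph r t)])
    \/
    exists (N : {group {perm X}}) (gT : finGroupType) (T : {group gT}) (k r : nat),
      [/\ unique_minimal_normal G N,
          [/\ 1 <= k, simple T, ~~ (T \isog Zp 2) & N \isog gpower T k],
          3 <= r /\ graph_iso (normal_quotient N) (Cn r),
          (~~ abelian N -> (k <= r * 2 ^ r)%N)
        & (abelian N -> k <= r)].
Proof.
have [N minN _] := minimal_normal_exists kernel_normal oriented_kernel_nontriv.
have cycN := oriented_minimal_cyclic minN.
have [nNG ntN subN] := minimal_normalP minN.
have [r [l0 [r_gt2 isoN levl0]]] := cyclic_nq_level cycN.
have sameN : out_same a N by rewrite out_same_least.
have [l levl levS] := oriented_level oriG nNG r_gt2 levl0 sameN.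
have [N2 | nN2] := boolP (2.-group N); [left | right].
  split.
    apply: soc_pgroup => M minM; have [-> // | neqNM] := eqVneq (M : {set _}) N.
    by apply: (oriented_two_minimal minM minN); rewrite eq_sym.
  have solN := pgroup_sol N2.
  have [_ _ /is_abelemP[p p_pr abelN]] := minnormal_solvable (proj2 (andP minN)) (subxx _) solN.
  have p2 : p = 2.
    have [x Nx ntx] := trivgPn _ ntN.
    apply/eqP; move/pgroupP: N2; apply; rewrite // -(abelem_order_p abelN Nx ntx).
    exact: order_dvdG.
  have [|n Nn| | t [t_gt0 isoX]] := elementary_iso oriG edgeE nNG levl levS; last by exists r, t.
  - exact: abelem_abelian abelN.
  - by have [_ /(_ n Nn)] := abelemP p_pr abelN; rewrite p2 expgS expg1.
  - exact: subN.
have [T [k [k_gt0 [simT sTN] isoT oN kN]]] := minimal_normal_factor minN.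
exists N, _, T, k, r; split=> //.
- split=> // M minM; apply/eqP/idPn => neqMN.
  by case/negP: nN2; apply: oriented_two_minimal neqMN.
- split=> //; apply: contra nN2 => /card_isog oT.
  by rewrite /pgroup oN oT card_Zp // pnatX.
- move=> _; apply: leq_trans kN _.
  have oK := kernel_card oriG nNG r_gt2 levl levS.
  have iK := oriented_index oriG nNG r_gt2 levl levS.
  rewrite -(leq_pmul2l (cardG_gt0 N)) Lagrange ?normal_sub //.
  rewrite -(Lagrange (normal_sub (nq_kernel_normal nNG))) iK.
  by rewrite mulnC mulnCA leq_mul2l oK orbT.
move=> abN; have [p [p_pr abelN]] := oriented_abelian_bound minN abN nN2 r_gt2 levl levS.
by rewrite oN (simple_abelem_card abelN sTN simT) leq_exp2l ?prime_gt1.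
Qed.

End OrientedCase.

Section UnorientedCase.

Hypothesis split0 : ~~ out_same a N0.

Let nN0G : N0 <| G. Proof. exact: cycN0.1. Qed.

Lemma unoriented_cyclic N : cyclic_nq G N -> unoriented_nq G N.
Proof.
move=> cycN; have [r [l [r_gt2 isoN levl]]] := cyclic_nq_level cycN.
have splitN : ~~ out_same a N by rewrite out_same_least.
by exists r => //; split=> //; apply: (unoriented_isog oriG cycN.1 r_gt2 levl splitN).
Qed.

Lemma unoriented_cyclic_sub N : cyclic_nq G N -> N0 \subset N.
Proof.
move=> cycN; have [r [l [r_gt2 isoN levl]]] := cyclic_nq_level cycN.
have splitN : ~~ out_same a N by rewrite out_same_least.
rewrite (unoriented_kernel oriG cycN.1 r_gt2 levl splitN).
exact: subset_trans (nq_kernel_sub nN0G) (leastN0 cycN).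
Qed.

Section Level.

Variables (r : nat) (l : X -> 'Z_r).
Hypotheses (r_gt2 : 2 < r) (levl : cyclic_level a N0 l).

(** If N0 were trivial, levels would be single vertices and an in-neighbour of a
    vertex would also be one of its out-neighbours. *)
Lemma unoriented_nontriv : N0 :!=: 1.
Proof.
apply/negP=> /eqP N1; have [x _] := lev_surj levl 0%R.
have injl u v : l u = l v -> u = v.
  by case/(lev_orbitP levl)=> n; rewrite N1 => /set1P-> <-; rewrite perm1.
have [y [z [xy xz ly lz]]] := unoriented_out oriG nN0G levl split0 x.
have [u ux] := in_exists oriG x.
have xu : a x u.
  have [lx | lu] := lev_arc levl ux.
    by rewrite (injl u z) //; apply: (@GRing.addIr _ 1%R); rewrite -lx.
  by rewrite (injl u y) // lu.
by have := arc_asym oriG xu; rewrite ux.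
Qed.

(** The rotations in N form a normal subgroup of G. If it were trivial, N would
    have order 2, as the quotient of two reflections is a rotation; with two
    orbits there would be at most 4 vertices, fewer than a vertex and its 4
    neighbours. *)
Lemma unoriented_TI_rotations N : minimal_normal G N -> N :&: N0 = 1 ->
  #|orbits_of N| <= 2 -> forall n, n \in N -> exists c : 'Z_r, forall x, l (n x) = (l x + c)%R.
Proof.
move=> minN tiN o2; have [nNG ntN subN] := minimal_normalP minN.
have NG n : n \in N -> n \in G by apply/subsetP/normal_sub.
have act g : g \in G -> exists c : 'Z_r,
    (forall x, l (g x) = c + l x)%R \/ (forall x, l (g x) = c - l x)%R.
  exact: (lev_act oriG nN0G r_gt2 levl).
have [x0 _] := lev_surj levl 0%R.
pose rot (g : {perm X}) := [forall x, l (g x) - l x == l (g x0) - l x0]%R.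
have rotP (g : {perm X}) : reflect (exists c : 'Z_r, forall x, l (g x) = (l x + c)%R) (rot g).
  apply: (iffP forallP) => [eq_g | [c lg] x].
    by exists (l (g x0) - l x0)%R => x; rewrite -(eqP (eq_g x)); ring.
  by rewrite !lg; apply/eqP; ring.
have nrot g : g \in G -> ~~ rot g -> exists c : 'Z_r, forall x, l (g x) = (c - l x)%R.
  move=> Gg; have [c [lg|lg] nr] := act g Gg; last by exists c.
  by case/rotP: nr; exists c => x; rewrite lg GRing.addrC.
have gH : group_set [set n in N | rot n].
  apply/group_setP; split=> [|n m].
    by rewrite inE group1; apply/rotP; exists 0%R => x; rewrite perm1 GRing.addr0.
  rewrite !inE => /andP[Nn /rotP[c ln]] /andP[Nm /rotP[d lm]].
  by rewrite groupM //; apply/rotP; exists (c + d)%R => x; rewrite permM lm ln; ring.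
have nHG : Group gH <| G.
  apply/andP; split; first by apply/subsetP=> n; rewrite inE => /andP[/NG].
  apply/subsetP=> g Gg; rewrite inE; apply/subsetP=> _ /imsetP[n + ->].
  rewrite !inE => /andP[Nn /rotP[c ln]].
  rewrite memJ_norm ?(subsetP (normal_norm nNG)) // Nn.
  have [d [lg | lg]] := act g Gg; apply/rotP.
    exists c => x; rewrite -{1}[x](permKV g) permJ lg ln -[x in RHS](permKV g) lg; ring.
  exists (- c)%R => x; rewrite -{1}[x](permKV g) permJ lg ln -[x in RHS](permKV g) lg; ring.
suff ntH : Group gH :!=: 1.
  move=> n Nn; apply/rotP.
  suff : n \in Group gH by rewrite inE => /andP[].
  apply: subsetP Nn; apply: subN => //.
  by apply/subsetP=> m; rewrite inE => /andP[].
apply/negP=> /eqP H1.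
have oN : #|N| <= 2.
  have [n Nn ntn] := trivgPn _ ntN.
  have H1P m : m \in N -> rot m -> m = 1.
    by move=> Nm rm; apply/set1P; rewrite -[[set 1]]H1 inE Nm.
  have nr m : m \in N -> m != 1 -> ~~ rot m.
    by move=> Nm; apply: contraNN => rm; apply/eqP/H1P.
  have sN : N \subset [set 1; n].
    apply/subsetP=> m Nm; rewrite !inE; case: eqP => //= /eqP ntm.
    rewrite eq_mulgV1; apply/eqP/H1P; first by rewrite groupM ?groupV.
    have [c lm] := nrot _ (NG _ Nm) (nr m Nm ntm).
    have [d ln] : exists d : 'Z_r, forall x, l (n^-1 x) = (d - l x)%R.
      by apply: nrot; rewrite ?groupV ?NG // nr ?groupV // eq_invg1.
    by apply/rotP; exists (d - c)%R => x; rewrite permM ln lm; ring.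
  by apply: leq_trans (subset_leq_card sN) _; rewrite cards2; case: eqP.
have : 4 < #|X|.
  pose U := [set y | a x0 y]; pose V := [set y | a y x0].
  have UV : [disjoint U & V].
    by apply/pred0P=> y /=; rewrite !inE; apply/negP=> /andP[/(arc_asym oriG)/negP].
  have oUV : #|U :|: V| = 4.
    by rewrite cardsU disjoint_setI0 // cards0 subn0 (arc_out oriG) (arc_in oriG).
  have nx0 : x0 \notin U :|: V.
    by rewrite !inE orbb; apply/negP=> x00; have := arc_asym oriG x00; rewrite x00.
  have := max_card (mem (x0 |: (U :|: V))); rewrite cardsU1 nx0 oUV; apply: leq_trans.
  by [].
rewrite ltnNge (leq_trans (few_orbits_card o2)) //.
by rewrite -[4]/(2 * 2)%N leq_mul2l.
Qed.

(** Otherwise N commutes with N0. If the quotient by N is a cycle, N contains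
    N0. Otherwise N has at most two orbits and consists of rotations, so N0 has a
    single nontrivial element k, and N N0 is transitive. The involution t fixing
    v inverts N and fixes k, hence inverts an element y of N N0 carrying v to an
    out-neighbour w. Then t w is the image of v under the inverse of y, and it is
    at once an out-neighbour and an in-neighbour of v. *)
Lemma unoriented_not_TI N : minimal_normal G N -> N :&: N0 <> 1.
Proof.
move=> minN tiN; have [nNG ntN subN] := minimal_normalP minN.
have NG n : n \in N -> n \in G by apply/subsetP/normal_sub.
have KG n : n \in N0 -> n \in G by apply/subsetP/normal_sub.
have [cycN | o2] := degenerate_cases (basicG nNG ntN).
  case/eqP: unoriented_nontriv; rewrite -tiN; apply/esym/setIidPr.
  exact: unoriented_cyclic_sub.
have rotN := unoriented_TI_rotations minN tiN o2.
have comNK n k : n \in N -> k \in N0 -> commute n k.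
  exact: (normal_TI_commute nNG nN0G tiN).
have TIP n : n \in N -> n \in N0 -> n = 1.
  by move=> Nn Kn; apply/set1P; rewrite -[[set 1]]tiN inE Nn.
have freeK k x : k \in N0 -> k x = x -> k = 1.
  exact: (unoriented_free oriG nN0G r_gt2 levl split0).
have memK g : g \in G -> (forall x, l (g x) = l x) -> g \in N0.
  exact: (unoriented_mem oriG nN0G r_gt2 levl split0).
have levN n x : n \in N -> l (n x) = l x -> n = 1.
  move=> Nn ln; have [c lc] := rotN n Nn; apply: TIP => //; apply: memK => [|y].
    exact: NG.
  rewrite lc; suff -> : c = 0%R by rewrite GRing.addr0.
  by apply: (@GRing.addrI _ (l x)); rewrite -lc ln GRing.addr0.
have [v _] := lev_surj levl 0%R.
have [k Kk ntk] := trivgPn _ unoriented_nontriv.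
have offN k' : k' \in N0 -> k' != 1 -> k' v \notin orbit 'P N v.
  move=> Kk' ntk'; apply: contra ntk' => /orbitP[n Nn /= nv].
  have n1 : n = 1 by apply: (levN n v) => //; rewrite -[n v]/(aperm v n) nv (lev_norm levl).
  by apply/eqP/(freeK _ v) => //; rewrite -nv n1 apermE perm1.
have uniqK k' : k' \in N0 -> k' != 1 -> k' = k.
  move=> Kk' ntk'; have /orbitP[n Nn /= nv] := few_orbits o2 (offN k Kk ntk) (offN k' Kk' ntk').
  have n1 : n = 1.
    by apply: (levN n (k v)) => //; rewrite -[n _]/(aperm (k v) n) nv !(lev_norm levl).
  apply/eqP; rewrite eq_mulgV1; apply/eqP/(freeK _ v); first by rewrite groupM ?groupV.
  by rewrite permM -nv n1 apermE perm1 permK.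
have kk : k * k = 1.
  apply/eqP/idPn => ntkk; have := uniqK (k * k) (groupM Kk Kk) ntkk.
  by move/(canRL (mulgK k)); rewrite mulgV => k1; rewrite k1 eqxx in ntk.
have [t [Gt tv lt Kt stab]] := unoriented_stab oriG nN0G r_gt2 levl split0 v.
have kt : k ^ t = k.
  by apply: uniqK; rewrite ?conjg_eq1 // memJ_norm // (subsetP (normal_norm nN0G)).
have nt n : n \in N -> n ^ t = n^-1.
  move=> Nn; have Nnt : n ^ t \in N by rewrite memJ_norm // (subsetP (normal_norm nNG)).
  have [c ln] := rotN n Nn.
  suff : n ^ t * n = 1 by move/(canRL (mulgK n)); rewrite mul1g.
  apply: (levN _ v); first by rewrite groupM.
  by rewrite permM ln -{1}tv permJ lt ln; ring.
have [w vw] := out_exists oriG v.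
have [y [Gy yv yt]] : exists y, [/\ y \in G, y v = w & y ^ t = y^-1].
  have [/orbitP[n Nn nv] | ow] := boolP (w \in orbit 'P N v).
    by exists n; split; [exact: NG | exact: nv | exact: nt].
  have /orbitP[n Nn nv] := few_orbits o2 (offN k Kk ntk) ow.
  exists (k * n); split; first exact: groupM (KG k Kk) (NG n Nn).
    by rewrite permM; exact: nv.
  rewrite conjMg kt nt // invMg (comNK n^-1) ?groupV //.
  by congr (_ * _); apply/eqP; rewrite eq_sym eq_invg_mul kk.
have vtw : a v (t w) by rewrite -{1}tv (arc_act oriG).
have twE : t w = y^-1 v by rewrite -yv -yt -{2}tv permJ.
have := arc_asym oriG vw; rewrite -(arc_act oriG v (t w) Gy) twE permKV yv in vtw.
by rewrite vtw.
Qed.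

Lemma unoriented_minimal N : minimal_normal G N -> N :=: N0.
Proof.
move=> minN; have [nNG ntN subN] := minimal_normalP minN.
have [sNN0 | tiN] := minimal_normal_sub_or_TI minN nN0G; last by case: (unoriented_not_TI minN).
apply/eqP; rewrite eqEsubset sNN0 unoriented_cyclic_sub //.
apply: sub_kernel_cyclic => //.
exact: subset_trans sNN0 (nq_kernel_sub nN0G).
Qed.

Lemma unoriented_minimal_normal : minimal_normal G N0.
Proof.
have [N minN _] := minimal_normal_exists nN0G unoriented_nontriv.
by have /val_inj <- := unoriented_minimal minN.
Qed.

(** The element y = s s^t acts trivially on the levels and is conjugated by t
    and by s to the same element, so its centraliser contains N0 and t s^-1 and
    has index at most r. It is nontrivial: otherwise t would carry the
    out-neighbour s v of v to the in-neighbour s^-1 v. *)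
Lemma unoriented_grank : abelian N0 -> 'm(N0) <= r - 1.
Proof.
move=> abN; have [v _] := lev_surj levl 0%R.
have [t [Gt tv lt Nt stab]] := unoriented_stab oriG nN0G r_gt2 levl split0 v.
have [s [Gs vs ls]] := unoriented_rotation oriG nN0G r_gt2 levl split0 v.
have tt : t * t = 1.
  have [|//|tt] := stab (t * t) (groupM Gt Gt); first by rewrite permM !tv.
  by move/(canRL (mulgK t)): tt; rewrite mulgV => t1; rewrite t1 group1 in Nt.
pose y := s * s ^ t.
have lst u : l ((s ^ t)%g u) = (l u - 1)%R.
  by rewrite -[u in LHS](permKV t) permJ lt ls -[u in RHS](permKV t) lt; ring.
have Ny : y \in N0.
  apply: (unoriented_mem oriG nN0G r_gt2 levl split0) => [|u].
    by rewrite groupM ?groupJ.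
  by rewrite permM lst ls; ring.
have nty : y != 1.
  apply/negP=> /eqP y1; have stE : s ^ t = s^-1 by apply/eqP; rewrite eq_sym eq_invg_mul -y1.
  have : a v (s^-1 v) by rewrite -stE -{2}tv permJ -{1}tv (arc_act oriG).
  rewrite -(arc_act oriG _ _ Gs) permKV => sv.
  by have := arc_asym oriG vs; rewrite sv.
have yt : y ^ t = y ^ s.
  by rewrite conjMg -conjgM tt conjg1 [RHS]conjgE -[y * s]mulgA mulKg.
have cy : t * s^-1 \in 'C_G[y].
  rewrite inE groupM ?groupV //; apply/cent1P/commute_sym/commgP/conjg_fixP.
  by rewrite conjgM yt conjgK.
have sNC : N0 \subset 'C_G[y].
  by rewrite subsetI normal_sub //= -cent_set1 centsC sub1set (subsetP abN).
have ltNC : 1 < #|'C_G[y] : N0|.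
  rewrite indexg_gt1; apply/negP=> /subsetP/(_ _ cy) Nts.
  have lv := ls (s^-1 v); rewrite permKV in lv.
  have := lev_norm levl v Nts; rewrite permM tv => lsv.
  by move/eqP: lv; rewrite lsv Zp_succ_neq.
have oC : #|y ^: G| <= r.
  rewrite -index_cent1 -(leq_pmul2r (m := 2)) // [X in _ <= X]mulnC.
  rewrite -(unoriented_index oriG nN0G r_gt2 levl split0).
  rewrite -(Lagrange_index (subsetIl G 'C[y]) sNC) leq_mul2l ltNC.
  by rewrite orbT.
have minN : minnormal N0 G by case/andP: unoriented_minimal_normal.
apply: leq_trans (minnormal_class_grank minN Ny nty) _.
rewrite geq_max -(subn1 #|_|) leq_sub2r // andbT.
by rewrite ltn_subRL ltnW.
Qed.

End Level.

Lemma unoriented_conclusion :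
  exists (N : {group {perm X}}) (gT : finGroupType) (T : {group gT}) (k r : nat),
     [/\ unique_minimal_normal G N,
         1 <= k /\ simple T /\ N \isog gpower T k,
         3 <= r /\ graph_iso (normal_quotient N) (Cn r),
         (~~ abelian N -> (k <= 2 * r)%N)
       & (abelian N -> (k <= r - 1)%N)].
Proof.
have [r [l [r_gt2 isoN levl]]] := cyclic_nq_level cycN0.
have minN := unoriented_minimal_normal r_gt2 levl.
have [T [k [k_gt0 [simT sTN] isoT oN kN]]] := minimal_normal_factor minN.
exists N0, _, T, k, r; split=> //.
- by split=> // M minM; apply: (unoriented_minimal r_gt2 levl minM).
- by move=> _; rewrite -(unoriented_index oriG nN0G r_gt2 levl split0).
move=> abN; apply: leq_trans (unoriented_grank r_gt2 levl abN).
have [p p_pr abelN] := abelian_minimal_normal minN abN.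
rewrite grank_abelian // (rank_abelem abelN) oN.
by rewrite (simple_abelem_card abelN sTN simT) pfactorK.
Qed.

End UnorientedCase.

End Pair.

(** * The classification *)

Theorem theorem1p1 (X : sgraph) (G : {group {perm X}})
    (hOG : OG4 G) (hbasic : basic_pair G) (hcycle : cycle_type G)
    (hindep : ~ has_independent_nq G) :
  ((forall N : {group {perm X}}, cyclic_nq G N -> oriented_nq G N) /\
   ((2.-group (soc G) /\
     exists r t : nat, [/\ 3 <= r, 1 <= t & graph_iso X (C2_graph r t)])
    \/
    exists (N : {group {perm X}}) (gT : finGroupType) (T : {group gT}) (k r : nat),
      [/\ unique_minimal_normal G N,
          [/\ 1 <= k, simple T, ~~ (T \isog Zp 2) & N \isog gpower T k],
          3 <= r /\ graph_iso (normal_quotient N) (Cn r),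
          (~~ abelian N -> (k <= r * 2 ^ r)%N)
        & (abelian N -> k <= r)]))
  \/
  ((forall N : {group {perm X}}, cyclic_nq G N -> unoriented_nq G N) /\
   exists (N : {group {perm X}}) (gT : finGroupType) (T : {group gT}) (k r : nat),
     [/\ unique_minimal_normal G N,
         1 <= k /\ simple T /\ N \isog gpower T k,
         3 <= r /\ graph_iso (normal_quotient N) (Cn r),
         (~~ abelian N -> (k <= 2 * r)%N)
       & (abelian N -> (k <= r - 1)%N)]).
Proof.
have [a oriG edgeE] := orientation_exists hOG.
have [N0 cycN0 leastN0] := least_cyclic_kernel hcycle hindep.
have [same0 | split0] := boolP (out_same a N0); [left | right]; split.
- exact: (oriented_cyclic oriG edgeE cycN0 leastN0 same0).
- exact: (oriented_conclusion oriG edgeE hbasic cycN0 leastN0 same0).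
- exact: (unoriented_cyclic oriG edgeE cycN0 leastN0 split0).
exact: (unoriented_conclusion oriG edgeE hbasic cycN0 leastN0 split0).
Qed.
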